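(* Let $p$ be a prime and $k\geq 0$ an integer. There exist $\delta_0\in(0,1)$ and a constant $\sigma_{p,k}>0$ such that, setting $\psi(\delta)=\sigma_{p,k}\log(\delta^{-1})^{-1/5}$, the following holds for all $0<\delta<\delta_0$ and all $0<\epsilon\leq(\delta/120)^{k+1}$. Let $G=\mathbb{F}_p^n$, $H\leqslant G$, and let $(G;A_0,A_1,A_2)$ be a $3$-coloring of $G$ with $|A_2|\leq\epsilon|G|$. Suppose $A_1|A_0$ has $\mathrm{VC}$-dimension less than $k$ relative to $H$. Then there is a subspace $H'\leqslant H$ such that (i) $H'$ has index at most $\delta^{-k-\psi(\delta)}$ in $H$; (ii) for each $u\in\{0,1\}$ and all $h\in H'$, $|A_u\Delta(A_u-h)|\leq 4\delta^{1-\psi(\delta)}|G|$; (iii) for each $u\in\{0,1\}$ there is a union $Y_u$ of cosets of $H'$ in $G$ with $|A_u\Delta Y_u|\leq 4\delta^{1-\psi(\delta)}|G|$.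
   Context: A $3$-coloring of a group $G$ is a tuple $(G;A_0,A_1,A_2)$ where $A_0,A_1,A_2$ partition $G$. For $H\leqslant G$, $A_1|A_0$ has $\mathrm{VC}$-dimension at least $k$ relative to $H$ if there are $v_1,\dots,v_k\in G$ and for each $S\subseteq[k]$ an element $w_S\in H$ such that $i\in S$ implies $v_i+w_S\in A_1$ and $i\notin S$ implies $v_i+w_S\in A_0$. ''$\mathrm{VC}$-dimension less than $k$ relative to $H$'' means it does not have $\mathrm{VC}$-dimension at least $k$ relative to $H$. *)

(* Defs.v *)
From HB Require Import structures.
From mathcomp Require Import all_boot all_order all_algebra all_fingroup.
From mathcomp Require Import reals exp.

Set Implicit Arguments.
Unset Strict Implicit.
Unset Printing Implicit Defensive.

Import Order.TTheory GRing.Theory Num.Theory.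
Local Open Scope ring_scope.

(* The color classes may be empty, unlike the blocks of [finset.partition]. *)
Definition three_coloring (G : finType) (A0 A1 A2 : {set G}) : Prop :=
  [/\ A0 :|: A1 :|: A2 = [set: G],
      [disjoint A0 & A1], [disjoint A0 & A2] & [disjoint A1 & A2]].

Definition VC_dim_at_least (G : finZmodType) (A1 A0 : {set G})
    (H : {pred G}) (k : nat) : Prop :=
  exists (v : 'I_k -> G) (w : {set 'I_k} -> G),
    forall S : {set 'I_k},
      w S \in H /\
      forall i : 'I_k,
        (i \in S -> v i + w S \in A1) /\ (i \notin S -> v i + w S \in A0).

Definition symdiff (T : finType) (A B : {set T}) : {set T} :=
  (A :\: B) :|: (B :\: A).

Definition shift_sub (G : finZmodType) (A : {set G}) (h : G) : {set G} :=
  [set a - h | a in A].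

Definition union_of_cosets (G : finZmodType) (K : {pred G}) (Y : {set G}) : Prop :=
  exists B : {set G}, Y = \bigcup_(b in B) [set b + h | h in K].

Definition psi (R : realType) (sigma delta : R) : R :=
  sigma * ln (delta^-1) `^ (- 5^-1).

(* Main.v *)
Require Import Defs.
From HB Require Import structures.
From mathcomp Require Import all_boot all_order all_algebra all_fingroup.
From mathcomp Require Import reals exp.
From mathcomp Require Import sequences ring lra zify complex.

Set Implicit Arguments.
Unset Strict Implicit.
Unset Printing Implicit Defensive.

Import Order.TTheory GRing.Theory Num.Theory.
Local Open Scope ring_scope.

(* By Sauer-Shelah and greedy sampling, a family of about delta^-k shifts of A1
   by elements of H that are pairwise delta-far shatters k points, the error
   class A2 being too small to interfere. Hence the ball
     B_delta = {h in H : |A1 symdiff (A1 - h)| <= delta |G|}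
   has density at least delta^k in H. Among log(1/delta)^(4/5) scales
   delta 16^i one finds a ball whose 16-fold dilate is at most K times as large,
   with log K = O(log(1/delta)^(1/5)). Factoring out a maximal subspace Z that
   meets the dilate only in 0 makes the ball dense, so Sanders' quasipolynomial
   Bogolyubov-Ruzsa lemma (Croot-Sisask almost periodicity and Chang's theorem)
   yields a subspace of codimension O(log^4 K) inside a slightly larger ball,
   and intersecting the cosets of Z with that ball lifts it back to H.
   For p fixed, only the dense case of Bogolyubov-Ruzsa is needed. *)

(** * Power means and exponential moments *)

(** The exponent 1/5 balances two losses. Going through [M] scales multiplies distances by up to
    [16 ^ M]; doubling [2 ^ s] at the chosen scale costs a power of [p] of order [s ^ 4] in the
    index; and the pigeonhole needs [s * M] of order log(1/delta), because the smallest ball has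
    density about delta^k. Equating [M] with [s ^ 4] gives [s] of order log(1/delta)^(1/5). The
    fourth power comes from the almost periods. Their density is about 2^(-s q m^2): the moment q
    must be of order [s] for an average over the whole group to say something about a set of density
    2^(-s), and the precision 1/m must be of order 1/s to survive about [s] successive averagings.
    Chang's theorem turns the logarithm of that density linearly into codimension. VC-dimension less
    than k allows only delta^(1-k) separated shifts, up to powers of log(1/delta). The missing
    factor 1/delta absorbs these logarithms for small delta, which is why the ball has density
    delta^k with no further loss. *)

Lemma sqr_sum_le (R : realFieldType) (I : finType) (A : {pred I}) (F : I -> R) :
  (\sum_(i in A) F i) ^+ 2 <= #|A|%:R * \sum_(i in A) F i ^+ 2.
Proof.
have : 0 <= \sum_(i in A) \sum_(j in A) (F i - F j) ^+ 2.
  by do 2!apply: sumr_ge0 => ? _; rewrite sqr_ge0.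
under eq_bigr => i _.
  under eq_bigr => j _ do rewrite sqrrB.
  rewrite big_split sumrB /= sumr_const sumrMnl -mulr_sumr.
  over.
rewrite big_split sumrB /= !sumr_const !sumrMnl -mulr_suml.
set S := \sum_(i in A) F i; set Q := \sum_(i in A) F i ^+ 2.
rewrite -[Q *+ _]mulr_natl; nra.
Qed.

(** Cauchy-Schwarz once per squaring. The almost-periodicity argument uses moments of exponent
    [2 ^ j] so that this induction suffices. The factor [#|A|] on the left stands for an exponent
    [2 ^ j - 1] on the right. *)
Lemma expr_sum_le (R : realFieldType) (I : finType) (A : {pred I}) j :
  forall F : I -> R,
  #|A|%:R * (\sum_(i in A) F i) ^+ (2 ^ j)
    <= #|A|%:R ^+ (2 ^ j) * \sum_(i in A) F i ^+ (2 ^ j).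
Proof.
elim: j => [|j IHj] F; first by rewrite !expr1.
have eM (x : R) : x ^+ (2 ^ j.+1) = (x ^+ 2) ^+ (2 ^ j) by rewrite expnS exprM.
have h : ((\sum_(i in A) F i) ^+ 2) ^+ (2 ^ j)
    <= #|A|%:R ^+ (2 ^ j) * (\sum_(i in A) F i ^+ 2) ^+ (2 ^ j).
  rewrite -(exprMn (2 ^ j)%N) lerXn2r ?sqr_sum_le // nnegrE ?sqr_ge0 // mulr_ge0 //.
  by apply: sumr_ge0 => i _; rewrite sqr_ge0.
rewrite !eM; apply: (le_trans (ler_wpM2l (ler0n R _) h)).
rewrite mulrCA exprAC expr2 -mulrA.
apply: ler_wpM2l; first exact: exprn_ge0.
under [X in _ <= _ * X]eq_bigr => i _ do rewrite eM.
exact: IHj.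
Qed.

Lemma expr_addr_le (R : realFieldType) j (a b : R) :
  2 * (a + b) ^+ (2 ^ j) <= 2 ^+ (2 ^ j) * (a ^+ (2 ^ j) + b ^+ (2 ^ j)).
Proof.
have := expr_sum_le [set: bool] j (fun x => if x then a else b).
have h (F : bool -> R) : \sum_(i in [set: bool]) F i = F true + F false.
  by rewrite (eq_bigl xpredT) ?big_bool // => i; rewrite inE.
by rewrite !h cardsT card_bool.
Qed.

(** From [1 - u <= expR (- u)] one gets [expR u * (1 - u) <= 1], while (1 + u + 2u^2)(1 - u) = 1 +
    u^2 (1 - 2u) is at least 1 in this range. *)
Lemma expR_le_quad (R : realType) (u : R) :
  `|u| <= 2^-1 -> expR u <= 1 + u + 2 * u ^+ 2.
Proof.
rewrite ler_norml => /andP[lo hi].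
have : 1 - u <= expR (- u) by apply: expR_ge1Dx.
rewrite expRN => h; have e0 := expR_gt0 u.
have {h} : expR u * (1 - u) <= 1.
  by rewrite -[leRHS](divff (lt0r_neq0 e0)) ler_wpM2l // expR_ge0.
nra.
Qed.

Lemma expR1_le4 (R : realType) : expR 1 <= 4 :> R.
Proof.
have hy : expR (2^-1) <= 1 + 2^-1 + 2 * 2^-1 ^+ 2 :> R.
  by apply: expR_le_quad; rewrite ger0_norm // invr_ge0.
have -> : expR 1 = expR (2^-1) * expR (2^-1) :> R by rewrite -expRD; congr expR; lra.
have y2 : expR (2^-1) <= 2 :> R by lra.
have := expR_gt0 (2^-1 : R); nra.
Qed.

(** Independence: the sum over tuples factors into one sum per coordinate. In each of them the
    linear term of [expR_le_quad] cancels because [Z i] has mean zero, leaving [1 + 2 * lam ^+ 2]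
    per sample. *)
Lemma sum_expR_tuples_le (R : realType) (I T : finType) (A : {pred T})
    (Z : I -> T -> R) (lam : R) :
  0 <= lam <= 2^-1 ->
  (forall i t, `|Z i t| <= 1) ->
  (forall i, \sum_(t in A) Z i t = 0) ->
  \sum_(a : {ffun I -> T} | a \in ffun_on A) expR (lam * \sum_i Z i (a i))
    <= #|A|%:R ^+ #|I| * expR (2 * lam ^+ 2 * #|I|%:R).
Proof.
move=> /andP[l0 l1] Z1 Z0.
under eq_bigr => a _ do rewrite mulr_sumr expR_sum.
rewrite -(@bigA_distr_big _ _ _ _ _ _ _ A (fun i t => expR (lam * Z i t))).
rewrite mulrC expRM_natr -exprMn mulrC -[leRHS]prodr_const.
apply: ler_prod => i _; apply/andP; split.
  by apply: sumr_ge0 => t _; rewrite expR_ge0.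
have h t : t \in A ->
   expR (lam * Z i t) <= 1 + lam * Z i t + 2 * lam ^+ 2.
  move=> _; have := Z1 i t => Zit.
  have : `|lam * Z i t| <= 2^-1.
    rewrite normrM (ger0_norm l0) -[leRHS]mulr1.
    by apply: ler_pM.
  move=> /expR_le_quad/le_trans; apply.
  rewrite lerD2l ler_pM2l // exprMn ler_piMr ?sqr_ge0 //.
  by rewrite -real_normK ?num_real // expr_le1.
apply: (le_trans (ler_sum _ h)).
rewrite !big_split /= !sumr_const -mulr_sumr Z0 mulr0 addr0 -mulrnDl -[leLHS]mulr_natl.
by apply: ler_wpM2l; rewrite ?ler0n ?expR_ge1Dx.
Qed.

Lemma expr_le_fact_expR (R : realType) (u : R) (q : nat) : ~~ odd q ->
  u ^+ q <= q`!%:R * (expR u + expR (- u)).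
Proof.
case: q => [|q] qe.
  rewrite expr0 mul1r; have := expR_ge1Dx u; have := expR_ge1Dx (- u); lra.
wlog u0 : u / 0 <= u => [h|].
  have [/h//|/ltW u0] := leP 0 u.
  by have := h (- u); rewrite oppr_ge0 exprNn -signr_odd (negbTE qe) mul1r opprK addrC; apply.
have := @expR_ge1Dxn _ u q u0 => h.
have h2 : u ^+ q.+1 / (q.+1)`!%:R <= expR u + expR (- u).
  by have := expR_ge0 (- u); lra.
by rewrite mulrC -ler_pdivrMr // ltr0n fact_gt0.
Qed.

Lemma fact_le_expn q : (q`! <= q ^ q)%N.
Proof.
rewrite fact_prod big_add1 big_mkord -[X in (_ <= _ ^ X)%N]card_ord -prod_nat_const.
by apply: leq_prod => i _; rewrite ltn_ord.
Qed.

(** With [q * m ^ 2] samples and [lam] = 1/m the exponent [2 * lam ^+ 2 * #|I|] is exactly 2q, so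
    the exponential moment costs only [16 ^+ q]. Against the trivial bound (q m^2)^q this saves a
    factor of order m inside the power. *)
Lemma moment_tuples_le (R : realType) (I T : finType) (A : {pred T})
    (Z : T -> R) (q m : nat) :
  ~~ odd q -> (1 < m)%N -> #|I| = (q * m ^ 2)%N ->
  (forall t, `|Z t| <= 1) ->
  \sum_(t in A) Z t = 0 ->
  \sum_(a : {ffun I -> T} | a \in ffun_on A) (\sum_i Z (a i)) ^+ q
    <= #|A|%:R ^+ #|I| * (2 * (16 * q%:R * m%:R) ^+ q).
Proof.
move=> qe m1 cI Z1 Z0.
have m0 : 0 < m%:R :> R by rewrite ltr0n; apply: ltn_trans m1.
pose lam : R := m%:R^-1.
have lam_itv : 0 <= lam <= 2^-1.
  by rewrite invr_ge0 ltW //= lef_pV2 ?posrE // ler_nat.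
have E : 2 * lam ^+ 2 * #|I|%:R = 2 * q%:R.
  rewrite cI natrM natrX /lam; field; exact: lt0r_neq0.
have M1 := @sum_expR_tuples_le _ I _ A (fun=> Z) _ lam_itv (fun=> Z1) (fun=> Z0).
have M2 : \sum_(a : {ffun I -> T} | a \in ffun_on A) expR (lam * \sum_i - Z (a i))
    <= #|A|%:R ^+ #|I| * expR (2 * lam ^+ 2 * #|I|%:R).
  apply: (@sum_expR_tuples_le _ I _ A (fun _ t => - Z t)) => //.
    by move=> _ t; rewrite normrN.
  by rewrite sumrN Z0 oppr0.
rewrite E in M1 M2.
have h (a : {ffun I -> T}) : a \in ffun_on A ->
  (\sum_i Z (a i)) ^+ q <= (m%:R ^+ q * q`!%:R) *
    (expR (lam * \sum_i Z (a i)) + expR (lam * \sum_i - Z (a i))).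
  move=> _; set u := \sum_i _.
  have := expr_le_fact_expR (lam * u) qe.
  rewrite exprMn exprVn mulrC ler_pdivrMr ?exprn_gt0 //.
  by rewrite sumrN mulrN mulrC mulrA.
apply: (le_trans (ler_sum _ h)); rewrite -mulr_sumr big_split /=.
have e16 : expR (2 * q%:R) <= 16 ^+ q :> R.
  rewrite mulrC expRM_natl lerXn2r ?nnegrE ?expR_ge0 //.
  rewrite -[2]mul1r expRM_natr; have -> : (16 : R) = 4 ^+ 2 by rewrite -natrX.
  by rewrite lerXn2r ?nnegrE ?expR_ge0 // expR1_le4.
have qf : q`!%:R <= q%:R ^+ q :> R by rewrite -natrX ler_nat fact_le_expn.
set X := #|A|%:R ^+ #|I| in M1 M2 *.
have X0 : 0 <= X by rewrite exprn_ge0.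
apply: (@le_trans _ _ (m%:R ^+ q * q%:R ^+ q * (2 * (X * 16 ^+ q)))); last first.
  rewrite !exprMn le_eqVlt; apply/orP; left; apply/eqP; ring.
apply: ler_pM.
- by rewrite mulr_ge0 // exprn_ge0.
- by rewrite addr_ge0 // sumr_ge0 // => a _; rewrite expR_ge0.
- by rewrite ler_wpM2l // exprn_ge0.
have := ler_wpM2l X0 e16; lra.
Qed.

(** * Fourier analysis on F_p^n *)

Definition additive_character p (C : numClosedFieldType) (e : 'F_p -> C) : Prop :=
  [/\ {morph e : a b / a + b >-> a * b}, forall a, `|e a| = 1
    & forall a, e a = 1 -> a = 0].

(** A root of 1 + X + ... + X^(p-1) is a p-th root of unity, and it differs from 1 because p is
    nonzero in [C]; p being prime, its order is p. *)
Lemma additive_character_exists p (C : numClosedFieldType) :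
  prime p -> exists e : 'F_p -> C, additive_character e.
Proof.
move=> p_pr; have p0 := prime_gt0 p_pr; have p1 := prime_gt1 p_pr.
have [z] : exists z : C, root (\poly_(i < p) 1) z.
  by apply/closed_rootP; rewrite size_poly_eq ?oner_eq0 // neq_ltn p1 orbT.
rewrite /root horner_poly => /eqP z_root.
have zp : z ^+ p = 1.
  apply/eqP; rewrite -subr_eq0 subrX1.
  by under eq_bigr => i _ do rewrite -[_ ^+ i]mul1r; rewrite z_root mulr0.
have z1 : z != 1.
  apply/eqP => z1; move: z_root; rewrite z1.
  under eq_bigr => i _ do rewrite expr1n mulr1.
  rewrite sumr_const card_ord => /eqP; rewrite pnatr_eq0 => /eqP pE.
  by rewrite pE in p0.
exists (fun a => z ^+ a); split.
- have zp' : z ^+ (Zp_trunc (pdiv p)).+2 = 1 by rewrite Fp_cast.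
  by move=> a b; rewrite -exprD -[RHS](expr_mod _ zp').
- move=> a; have : `|z| ^+ p = 1 by rewrite -normrX zp normr1.
  move=> /eqP; rewrite pexpr_eq1 // => /eqP nz.
  by rewrite normrX nz expr1n.
- move=> a /eqP; have [m zm mp] := prim_order_exists p0 zp.
  rewrite -(prim_order_dvd zm).
  have /primeP[_ /(_ _ mp) /orP[] /eqP E] := p_pr.
    by move: z1; rewrite -(prim_expr_order zm) E expr1 eqxx.
  rewrite E => pa; apply/eqP; rewrite -val_eqE /=.
  have al : (a < p)%N by rewrite -[X in (_ < X)%N](Fp_cast p_pr).
  by move: pa; rewrite /dvdn modn_small.
Qed.

Definition dot (F : fieldType) n (y x : 'rV[F]_n) : F := (y *m x^T) 0 0.

Lemma dotC (F : fieldType) n (y x : 'rV[F]_n) : dot y x = dot x y.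
Proof.
by rewrite /dot !mxE; apply: eq_bigr => i _; rewrite !mxE mulrC.
Qed.

Lemma dotDr (F : fieldType) n (y x x' : 'rV[F]_n) :
  dot y (x + x') = dot y x + dot y x'.
Proof. by rewrite /dot linearD mulmxDr mxE. Qed.

Lemma dotNr (F : fieldType) n (y x : 'rV[F]_n) : dot y (- x) = - dot y x.
Proof. by rewrite /dot linearN mulmxN mxE. Qed.

Lemma dot_delta (F : fieldType) n (x : 'rV[F]_n) i : dot (delta_mx 0 i) x = x 0 i.
Proof. by rewrite /dot -rowE !mxE. Qed.

Definition average (K : fieldType) (U : finZmodType) (X : {pred U}) (f : U -> K) x : K :=
  #|X|%:R^-1 * \sum_(t in X) f (x + t).

Section Fourier.
Context p (C : numClosedFieldType) (e : 'F_p -> C) (eP : additive_character e).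
Context (n : nat).
Local Notation U := 'rV['F_p]_n.
Implicit Types (f g : U -> C) (x y : U) (X : {pred U}) (V : {vspace U}).

Lemma additive_character0 : e 0 = 1.
Proof.
have [eD e1 _] := eP; have := eD 0 0; rewrite addr0 => /eqP.
rewrite -[X in X == _]mulr1 (inj_eq (mulfI _)); first by move/eqP.
by rewrite -normr_eq0 e1 oner_eq0.
Qed.

Lemma additive_characterN a : e (- a) = (e a)^*.
Proof.
have [eD e1 _] := eP.
have ea0 : e a != 0 by rewrite -normr_eq0 e1 oner_eq0.
apply: (mulfI ea0); rewrite -eD subrr additive_character0.
by rewrite -normCK e1 expr1n.
Qed.

Lemma sum_character_subspace V y :
  (exists2 v, v \in V & dot y v != 0) -> \sum_(v in V) e (dot y v) = 0.
Proof.
have [eD e1 einj] := eP => -[v vV yv].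
have e_v : e (dot y v) - 1 != 0.
  by rewrite subr_eq0; apply: contra yv => /eqP/einj/eqP.
apply: (mulfI e_v); rewrite mulr0 mulrBl mul1r mulr_sumr.
under eq_bigr => i _ do rewrite -eD -dotDr.
rewrite [X in _ - X](reindex_inj (addrI v)) /=.
apply/eqP; rewrite subr_eq0; apply/eqP/eq_bigl => i.
by rewrite rpredDl.
Qed.

Lemma sum_character x :
  \sum_y e (dot y x) = #|{: U}|%:R * (x == 0)%:R.
Proof.
have [->|x0] := eqVneq x 0.
  rewrite mulr1 (eq_bigr (fun=> 1)) ?sumr_const // => y _.
  by rewrite /dot trmx0 mulmx0 mxE additive_character0.
rewrite mulr0.
under eq_bigr => y _ do rewrite dotC.
rewrite (eq_bigl (mem (fullv : {vspace U}))); last by move=> y; rewrite /= memvf.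
apply: sum_character_subspace.
move: x0 => /rV0Pn[i xi].
by exists (delta_mx 0 i); rewrite ?memvf // dotC dot_delta.
Qed.

Definition fourier f y : C := \sum_x f x * (e (dot y x))^*.

Lemma plancherel f g :
  \sum_y fourier f y * (fourier g y)^* = #|{: U}|%:R * \sum_x f x * (g x)^*.
Proof.
have [eD _ _] := eP.
transitivity (\sum_y \sum_x \sum_x' f x * (g x')^* * e (dot y (x' - x))).
  apply: eq_bigr => y _; rewrite /fourier rmorph_sum mulr_suml.
  apply: eq_bigr => x _; rewrite mulr_sumr; apply: eq_bigr => x' _.
  rewrite rmorphM /= conjCK dotDr dotNr eD additive_characterN; ring.
rewrite exchange_big mulr_sumr; apply: eq_bigr => x _ /=.
rewrite exchange_big /= (bigD1 x) //= [X in _ + X]big1 ?addr0 => [|x' xx'].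
  by rewrite -mulr_sumr sum_character subrr eqxx mulr1 mulrC.
by rewrite -mulr_sumr sum_character subr_eq0 (negbTE xx') !mulr0.
Qed.

Definition character_mean X y : C := #|X|%:R^-1 * \sum_(t in X) e (dot y t).

Lemma fourier_average X f y :
  fourier (average X f) y = character_mean X y * fourier f y.
Proof.
have [eD _ _] := eP.
rewrite /fourier /average /character_mean.
under eq_bigr => x _ do rewrite -mulrA.
rewrite -mulr_sumr -mulrA; congr (_ * _).
under eq_bigr => x _ do rewrite mulr_suml.
rewrite exchange_big /= mulr_suml; apply: eq_bigr => t _.
rewrite (reindex_inj (addIr (- t))) /= mulr_sumr; apply: eq_bigr => x _.
rewrite subrK dotDr dotNr eD additive_characterN rmorphM /= conjCK.
ring.
Qed.

Lemma fourier_iter_average X l f y :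
  fourier (iter l (average X) f) y = character_mean X y ^+ l * fourier f y.
Proof.
elim: l => [|l IHl]; first by rewrite mul1r.
by rewrite iterS fourier_average IHl mulrA exprS.
Qed.

Lemma character_mean_subspace V y :
  character_mean V y = (if [forall v in V, dot y v == 0] then 1 else 0).
Proof.
rewrite /character_mean; case: ifPn => [/forall_inP yV|].
  rewrite (eq_bigr (fun=> 1)) => [|v /yV/eqP->]; last exact: additive_character0.
  rewrite sumr_const mulVf // pnatr_eq0 -lt0n.
  by apply/card_gt0P; exists 0; apply: mem0v.
rewrite negb_forall_in => /exists_inP[v vV yv].
by rewrite sum_character_subspace ?mulr0 //; exists v.
Qed.

Lemma parseval f : \sum_y `|fourier f y| ^+ 2 = #|{: U}|%:R * \sum_x `|f x| ^+ 2.
Proof.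
under eq_bigr => y _ do rewrite normCK.
by rewrite plancherel; under eq_bigr => x _ do rewrite -normCK.
Qed.

(** On the Fourier side the difference multiplies by mu^l (1 - nu), with mu and nu the character
    means of [X] and [V]. Where |mu| >= 1/2, [V] annihilates the frequency and nu = 1; elsewhere
    |mu|^l <= 2^(-l). The pairing with [g] is then bounded by 2ab <= a^2 + b^2 and Parseval. *)
Lemma smoothing_le X V l f g :
  (forall y, 2^-1 <= `|character_mean X y| -> forall v, v \in V -> dot y v = 0) ->
  `|\sum_x (iter l (average X) f x - iter l (average X) (average V f) x) * (g x)^*|
    <= 2^-1 ^+ l * (2^-1 * (\sum_x `|f x| ^+ 2 + \sum_x `|g x| ^+ 2)).
Proof.
move=> specV.
have N0 : 0 < #|{: U}|%:R :> C by rewrite ltr0n; apply/card_gt0P; exists 0.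
rewrite -(ler_pM2l N0) mulrCA -{1}(ger0_norm (ltW N0)) -normrM.
rewrite -plancherel.
have -> : #|{: U}|%:R * (2^-1 * (\sum_x `|f x| ^+ 2 + \sum_x `|g x| ^+ 2)) =
    \sum_y 2^-1 * (`|fourier f y| ^+ 2 + `|fourier g y| ^+ 2).
  by rewrite -mulr_sumr big_split /= !parseval -mulrDr mulrCA.
apply: (le_trans (ler_norm_sum _ _ _)).
rewrite mulr_sumr; apply: ler_sum => y _.
have -> : fourier (fun x => iter l (average X) f x - iter l (average X) (average V f) x) y
   = character_mean X y ^+ l * (1 - character_mean V y) * fourier f y.
  transitivity (fourier (iter l (average X) f) y - fourier (iter l (average X) (average V f)) y).
    by rewrite /fourier -sumrB; apply: eq_bigr => x _; rewrite mulrBl.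
  rewrite !fourier_iter_average fourier_average; ring.
rewrite !normrM norm_conjC -mulrA.
have h : `|fourier f y| * `|fourier g y| <=
    2^-1 * (`|fourier f y| ^+ 2 + `|fourier g y| ^+ 2).
  rewrite ler_pdivlMl // mulr_natl -subr_ge0 addrAC -sqrrB.
  by rewrite real_exprn_even_ge0 // rpredB ?normr_real.
apply: ler_pM => //; rewrite ?mulr_ge0 //.
rewrite normrX character_mean_subspace.
case: (boolP (2^-1 <= `|character_mean X y|)) => [/specV yV|].
  have -> : [forall v in V, dot y v == 0] by apply/forall_inP => v /yV->.
  by rewrite subrr normr0 mulr0 exprn_ge0 ?invr_ge0.
rewrite -real_ltNge ?normr_real ?rpredV ?realn // => lt.
apply: (@le_trans _ _ (`|character_mean X y| ^+ l * 1)).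
  apply: ler_wpM2l; first by rewrite exprn_ge0.
  by case: ifP; rewrite ?subrr ?normr0 ?subr0 ?normr1.
by rewrite mulr1 lerXn2r ?nnegrE ?invr_ge0 // ltW.
Qed.
End Fourier.

(** * Chang's theorem *)

Lemma sum_additive_character p (C : numClosedFieldType) (e : 'F_p -> C) :
  additive_character e -> \sum_a e a = 0.
Proof.
move=> [eD e1 einj].
have e_1 : e 1 - 1 != 0.
  by rewrite subr_eq0; apply/eqP => /einj/eqP; rewrite oner_eq0.
apply: (mulfI e_1); rewrite mulr0 mulrBl mul1r mulr_sumr.
under eq_bigr => i _ do rewrite -eD.
by rewrite [X in _ - X](reindex_inj (addrI 1)) subrr.
Qed.

Lemma Re_sum (R : rcfType) (I : Type) (r : seq I) (P : pred I) (F : I -> R[i]) :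
  complex.Re (\sum_(i <- r | P i) F i) = \sum_(i <- r | P i) complex.Re (F i).
Proof. by apply: big_morph => // -[a b] [c d]. Qed.

(** Linear independence of the rows becomes independence of the coordinates of [x *m Y^T]: the map
    is onto, [B] being a one-sided inverse of [Y^T], so every fibre is a coset of the kernel [V]. *)
Lemma sum_mulmx_row_free (F : finFieldType) (K : pzSemiRingType) d n (Y : 'M[F]_(d, n))
    (V : {pred 'rV[F]_n}) (h : 'rV[F]_d -> K) :
  row_free Y -> (forall v, (v \in V) = (v *m Y^T == 0)) ->
  \sum_(x : 'rV_n) h (x *m Y^T) = #|V|%:R * \sum_z h z.
Proof.
move=> Yfree VP.
have /row_fullP[B BY] : row_full Y^T by rewrite /row_full mxrank_tr.
rewrite (partition_big (fun x => x *m Y^T) predT) //= mulr_sumr.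
apply: eq_bigr => z _.
rewrite (eq_bigr (fun=> h z)) => [|x /eqP-> //].
rewrite sumr_const -[LHS]mulr_natl; congr (_%:R * _).
rewrite -[RHS](card_imset _ (addrI (z *m B))).
apply: eq_card => x; rewrite -[LHS]/(x *m Y^T == z).
apply/eqP/imsetP => [xz|[v + ->]].
  exists (x - z *m B); last by rewrite addrC subrK.
  by rewrite VP mulmxBl xz -mulmxA BY mulmx1 subrr.
by rewrite VP mulmxDl -mulmxA BY mulmx1 => /eqP->; rewrite addr0.
Qed.

Lemma sum_expR_row_le (R : realType) p d (Z : 'I_d -> 'F_p -> R) (lam : R) :
  prime p -> 0 <= lam <= 2^-1 ->
  (forall i t, `|Z i t| <= 1) -> (forall i, \sum_t Z i t = 0) ->
  \sum_(z : 'rV['F_p]_d) expR (lam * \sum_i Z i (z 0 i))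
    <= (p ^ d)%:R * expR (2 * lam ^+ 2 * d%:R).
Proof.
move=> p_pr lam_itv Z1 Z0.
have := @sum_expR_tuples_le R 'I_d 'F_p predT Z lam lam_itv Z1 Z0.
rewrite card_Fp // card_ord -natrX; apply: le_trans.
rewrite (reindex (fun a : {ffun 'I_d -> 'F_p} => \row_i a i)) /=; last first.
  exists (fun z => [ffun i => z 0 i]) => [a _|z _].
    by apply/ffunP => i; rewrite ffunE mxE.
  by apply/rowP => i; rewrite mxE ffunE.
rewrite le_eqVlt; apply/orP; left; apply/eqP.
apply: eq_big => [a|a _]; first by symmetry; apply/ffun_onP.
by congr (expR (_ * _)); apply: eq_bigr => i _; rewrite mxE.
Qed.

(* The exponential moment over X of the phase-aligned large characters is at most
   |G|/|X| times that over G, where independent characters are independent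
   random variables. *)
Lemma large_spectrum_annihilator (R : realType) p (e : 'F_p -> R[i]) n
    (X : {pred 'rV['F_p]_n}) (r : nat) :
  prime p -> additive_character e -> (0 < #|X|)%N ->
  (#|{: 'rV['F_p]_n}| <= 2 ^ r * #|X|)%N ->
  exists V : {vspace 'rV['F_p]_n},
    (forall y, 2^-1 <= `|character_mean e X y| -> forall v, v \in V -> dot y v = 0)
    /\ (#|{: 'rV['F_p]_n}| <= #|V| * p ^ (32 * r))%N.
Proof.
move=> p_pr eP X0 XN.
have [eD e1 einj] := eP.
pose spec := [set y | 2^-1 <= `|character_mean e X y|].
pose M : 'M['F_p]_(#|spec|, n) := \matrix_i enum_val i.
pose Y := rowsub (maxrankfun M) M.
set d := \rank M in Y *.
have Yfree : row_free Y by apply: maxrowsub_free.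
have specY y : y \in spec -> (y <= Y)%MS.
  move=> yS; rewrite /Y eq_maxrowsub.
  have -> : y = row (enum_rank_in yS y) M by rewrite rowK enum_rankK_in.
  exact: row_sub.
have Yspec i : row i Y \in spec.
  by rewrite row_rowsub rowK enum_valP.
pose V : {vspace 'rV['F_p]_n} := lker (linfun (mulmxr Y^T)).
have VP v : (v \in V) = (v *m Y^T == 0) by rewrite memv_ker lfunE.
have fibres := @sum_mulmx_row_free _ _ d n Y V _ Yfree VP.
have cardN : (#|{: 'rV['F_p]_n}| = #|V| * p ^ d)%N.
  have := fibres R (fun=> 1); rewrite !sumr_const -natrM.
  have cd : #|{: 'rV['F_p]_d}| = (p ^ d)%N by rewrite card_mx (card_Fp p_pr) mul1n.
  by move=> /eqP; rewrite eqr_nat -cd => /eqP.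
exists V; split=> [y yS v vV|].
  have /submxP[D ->] : (y <= Y)%MS by apply: specY; rewrite inE.
  rewrite /dot -mulmxA -[Y]trmxK -trmx_mul.
  by move: vV; rewrite VP => /eqP->; rewrite trmx0 mulmx0 mxE.
rewrite cardN leq_mul2l; apply/orP; right; rewrite leq_pexp2l ?prime_gt0 //.
pose nu i := character_mean e X (row i Y).
(* The phase [c i] makes the mean of the i-th character over [X] real and equal to [|nu i|]. The
   functions [Z i] thus have mean at least 1/2 along [X], yet sum to zero over the field. *)
pose c i : R[i] := (nu i)^* / `|nu i|.
pose Z i a : R := complex.Re (c i * e a).
have nu_ge i : 2^-1 <= `|nu i| by have := Yspec i; rewrite inE.
have nu0 i : `|nu i| != 0.
  by rewrite gt_eqF // (lt_le_trans _ (nu_ge i)) // invr_gt0.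
have c1 i : `|c i| = 1 by rewrite normrM norm_conjC normfV normr_id divff.
have Z1 i a : `|Z i a| <= 1.
  by rewrite -lecR; apply: (le_trans (normc_ge_Re _)); rewrite normrM c1 e1 mulr1.
have Z0 i : \sum_a Z i a = 0.
  by rewrite -Re_sum -mulr_sumr sum_additive_character // mulr0.
have dotY i x : dot (row i Y) x = (x *m Y^T) 0 i.
  by rewrite dotC /dot !mxE; apply: eq_bigr => j _; rewrite !mxE.
have ZX i : #|X|%:R / 2 <= \sum_(t in X) Z i ((t *m Y^T) 0 i).
  have -> : \sum_(t in X) Z i ((t *m Y^T) 0 i) = complex.Re (#|X|%:R * `|nu i|).
    rewrite -Re_sum -mulr_sumr; congr complex.Re.
    have -> : \sum_(t in X) e ((t *m Y^T) 0 i) = #|X|%:R * nu i.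
      rewrite /nu /character_mean mulrA divff ?mul1r ?pnatr_eq0 -?lt0n //.
      by apply: eq_bigr => t _; rewrite dotY.
    rewrite mulrCA; congr (_ * _); rewrite /c mulrAC -normCKC expr2.
    by rewrite mulfK.
  have := nu_ge i => /(ler_wpM2l (ler0n R[i] #|X|)).
  rewrite lecE => /andP[_]; apply: le_trans.
  rewrite -[2]/(2%:R) -(rmorph_nat (real_complex R) #|X|) -(rmorph_nat (real_complex R) 2).
  by rewrite -fmorphV -rmorphM.
(* The final comparison reads lam d/2 <= r + 2 lam^2 d. The value 1/8 maximises lam/2 - 2 lam^2,
   with maximum 1/32, whence [d <= 32 * r]. *)
pose lam : R := 8^-1.
have lam_itv : 0 <= lam <= 2^-1 by rewrite /lam; lra.
have up := sum_expR_row_le p_pr lam_itv Z1 Z0.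
have upV : \sum_(x : 'rV['F_p]_n) expR (lam * \sum_i Z i ((x *m Y^T) 0 i)) <=
    #|{: 'rV['F_p]_n}|%:R * expR (2 * lam ^+ 2 * d%:R).
  have -> : \sum_(x : 'rV['F_p]_n) expR (lam * \sum_i Z i ((x *m Y^T) 0 i)) =
      #|V|%:R * \sum_(z : 'rV_d) expR (lam * \sum_i Z i (z 0 i)).
    exact: (fibres R (fun z => expR (lam * \sum_i Z i (z 0 i)))).
  rewrite cardN natrM -mulrA.
  by rewrite ler_wpM2l.
pose u0 : R := lam * (d%:R / 2).
have low : #|X|%:R * expR u0 <= \sum_(x : 'rV['F_p]_n) expR (lam * \sum_i Z i ((x *m Y^T) 0 i)).
  apply: (@le_trans _ _ (\sum_(x in X) expR (lam * \sum_i Z i ((x *m Y^T) 0 i)))); last first.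
    by rewrite [leRHS](bigID (mem X)) /= lerDl sumr_ge0 // => i _; rewrite expR_ge0.
  (* The tangent line of the exponential at [u0] plays the role of Jensen's inequality. *)
  have h x : x \in X -> expR u0 * (1 + (lam * \sum_i Z i ((x *m Y^T) 0 i) - u0)) <=
      expR (lam * \sum_i Z i ((x *m Y^T) 0 i)).
    move=> _; set u := lam * _.
    have -> : expR u = expR u0 * expR (u - u0) by rewrite -expRD addrC subrK.
    by rewrite ler_wpM2l ?expR_ge0 ?expR_ge1Dx.
  apply: le_trans (ler_sum _ h).
  rewrite -mulr_sumr mulrC ler_wpM2l ?expR_ge0 //.
  rewrite big_split sumrB /= !sumr_const -mulr_sumr exchange_big /=.
  have : \sum_(i < d) #|X|%:R / 2 <= \sum_(i < d) \sum_(t in X) Z i ((t *m Y^T) 0 i).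
    exact: ler_sum.
  rewrite sumr_const card_ord -[_ *+ d]mulr_natl -[u0 *+ _]mulr_natl /u0.
  have /ler_wpM2l lam_le : 0 <= lam by case/andP: lam_itv.
  move=> /lam_le; rewrite lerDl subr_ge0; apply: le_trans.
  by rewrite mulrCA [X in lam * X]mulrCA.
have h : #|X|%:R * expR u0 <= #|X|%:R * (2 ^+ r * expR (2 * lam ^+ 2 * d%:R)).
  apply: (le_trans (le_trans low upV)).
  rewrite mulrA ler_wpM2r ?expR_ge0 //.
  by rewrite -natrX -natrM ler_nat mulnC.
rewrite ler_pM2l ?ltr0n // in h.
have two : 2 ^+ r <= expR r%:R :> R.
  rewrite -[r%:R]mul1r expRM_natr lerXn2r ?nnegrE ?expR_ge0 //.
  by have := expR_ge1Dx (1 : R).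
have := le_trans h (ler_wpM2r (expR_ge0 _) two).
rewrite -expRD ler_expR /u0 /lam => hh.
rewrite -(ler_nat R) natrM.
by move: (d%:R : R) (r%:R : R) hh; clear => x y; lra.
Qed.

(** * Croot-Sisask almost periodicity *)

Lemma expr_mean_le (R : realFieldType) (I : finType) (A : {pred I}) j (F : I -> R) :
  (0 < #|A|)%N ->
  (#|A|%:R^-1 * \sum_(i in A) F i) ^+ (2 ^ j)
    <= #|A|%:R^-1 * \sum_(i in A) F i ^+ (2 ^ j).
Proof.
move=> A0; have A0' : 0 < #|A|%:R :> R by rewrite ltr0n.
rewrite exprMn exprVn -(ler_pM2l A0') [leRHS]mulrA divff ?lt0r_neq0 // mul1r.
by rewrite mulrCA ler_pdivrMl ?exprn_gt0 // expr_sum_le.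
Qed.

Lemma markov_card (R : realFieldType) (T : finType) (A : {pred T}) (F : T -> R) (B : R) :
  (forall t, 0 <= F t) -> 0 < B -> \sum_(t in A) F t <= #|A|%:R * B ->
  (#|A| <= 2 * #|[pred t in A | (F t <= 2 * B)%R]|)%N.
Proof.
move=> F0 B0 le.
have E : #|A| = (#|[pred t in A | (F t <= 2 * B)%R]| + #|[pred t in A | ~~ ((F t <= 2 * B)%R)]|)%N.
  rewrite -(cardID [pred t | (F t <= 2 * B)%R] A); congr (_ + _)%N; apply: eq_card => t.
  by rewrite !inE andbC.
suff : (2 * #|[pred t in A | ~~ ((F t <= 2 * B)%R)]| <= #|A|)%N by rewrite E; lia.
have h : #|[pred t in A | ~~ ((F t <= 2 * B)%R)]|%:R * (2 * B) <= #|A|%:R * B.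
  apply: le_trans le.
  rewrite (bigID (fun t => F t <= 2 * B)) /= mulr_natl -sumr_const.
  rewrite -[leLHS]add0r lerD //; first by rewrite sumr_ge0.
  by apply: ler_sum => t; rewrite !inE => /andP[_]; rewrite -ltNge => /ltW.
rewrite -(ler_nat R) natrM mulrC -(ler_pM2r B0).
by rewrite -mulrA.
Qed.

Section CrootSisask.
Context (R : realType) (U : finZmodType).
Implicit Types (A X S : {pred U}) (f : U -> R).

(** For each t, translating all coordinates by t permutes the tuples, so the counts summed over all
    base points total [#|U| * #|L|]. The best base point does at least as well as the average. *)
Lemma dense_diagonal k (L : {pred {ffun 'I_k -> U}}) :
  exists a : {ffun 'I_k -> U},
    (#|U| * #|L| <= #|U| ^ k * #|[set t : U | [ffun i => (a i + t)%R] \in L]|)%N.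
Proof.
pose F (a : {ffun 'I_k -> U}) := #|[set t : U | [ffun i => (a i + t)%R] \in L]|.
have [a aP] : exists a, forall b, (F b <= F a)%N.
  have [a _ aP] := @arg_maxnP _ [ffun=> 0] predT F isT.
  by exists a => b; apply: aP.
exists a; rewrite -/(F a).
have -> : (#|U| ^ k = #|{: {ffun 'I_k -> U}}|)%N by rewrite card_ffun card_ord.
have <- : (\sum_b F b = #|U| * #|L|)%N.
  under eq_bigr => b _.
    rewrite /F -sum1dep_card big_mkcond /=; over.
  rewrite exchange_big /= -sum_nat_const; apply: eq_bigr => t _.
  rewrite -sum1_card [RHS]big_mkcond /=.
  rewrite [RHS](reindex (fun b : {ffun 'I_k -> U} => [ffun i => b i + t])) //=.
  by exists (fun b => [ffun i => b i - t]) => b _; apply/ffunP => i; rewrite !ffunE ?addrK ?subrK.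
by rewrite -sum_nat_const; apply: leq_sum => b _.
Qed.

(* Most tuples of samples from A approximate f, and since A is dense some diagonal
   coset contains many such tuples; the difference of two of them is an almost
   period. *)
Lemma croot_sisask A S j m s :
  (0 < j)%N -> (1 < m)%N -> (0 < #|A|)%N -> (#|U| <= 2 ^ s * #|A|)%N ->
  let f : U -> R := average A (fun x => (x \in S)%:R) in
  exists X : {set U},
    [/\ (0 < #|X|)%N, (#|U| <= 2 ^ (s * (2 ^ j * m ^ 2)).+1 * #|X|)%N
      & forall t, t \in X ->
          \sum_x (f (x + t) - f x) ^+ (2 ^ j) <= (128 / m%:R) ^+ (2 ^ j) * #|U|%:R].
Proof.
move=> j0 m1 A0 AU f.
set q := (2 ^ j)%N; set k := (q * m ^ 2)%N.
have q0 : (0 < q)%N by rewrite expn_gt0.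
have qe : ~~ odd q by rewrite oddX orbF -lt0n.
have m0 : (0 < m)%N by apply: ltn_trans m1.
have U0 : (0 < #|U|)%N by apply/card_gt0P; exists 0.
pose dev (a : {ffun 'I_k -> U}) x : R := \sum_i ((x + a i \in S)%:R - f x).
pose B : R := 2 * (16 * q%:R * m%:R) ^+ q.
have B0 : 0 < B by rewrite mulr_gt0 // exprn_gt0 // !mulr_gt0 // ltr0n.
have f01 x : 0 <= f x <= 1.
  rewrite /f /average mulr_ge0 ?invr_ge0 ?sumr_ge0 //=.
  rewrite ler_pdivrMl ?ltr0n // mulr1 -sum1_card natr_sum.
  by apply: ler_sum => t _; rewrite ler_nat leq_b1.
have devB x : \sum_(a : {ffun 'I_k -> U} | a \in ffun_on A) dev a x ^+ q
    <= #|A|%:R ^+ k * B.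
  have := @moment_tuples_le R 'I_k U A (fun t => (x + t \in S)%:R - f x) q m qe m1.
  rewrite card_ord; apply=> // [t|].
    by have /andP[] := f01 x; rewrite ler_norml; case: (_ \in S) => /=; lra.
  rewrite sumrB sumr_const -[f x *+ _]mulr_natl /f /average mulrA divff ?mul1r ?subrr //.
  by rewrite pnatr_eq0 -lt0n.
have cA : #|[pred a : {ffun 'I_k -> U} | a \in ffun_on A]| = (#|A| ^ k)%N.
  by rewrite -[X in (_ ^ X)%N]card_ord -card_ffun_on; apply: eq_card.
have devU : \sum_(a : {ffun 'I_k -> U} | a \in ffun_on A) \sum_x dev a x ^+ q
    <= #|[pred a : {ffun 'I_k -> U} | a \in ffun_on A]|%:R * (#|U|%:R * B).
  rewrite exchange_big /=.
  rewrite cA.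
  apply: (le_trans (ler_sum _ (fun x _ => devB x))).
  by rewrite sumr_const -[leLHS]mulr_natl natrX mulrCA.
have dev0 a x : 0 <= dev a x ^+ q by rewrite real_exprn_even_ge0 // num_real.
have := markov_card (fun a => sumr_ge0 _ (fun x _ => dev0 a x)) _ devU.
rewrite mulr_gt0 ?ltr0n // => /(_ isT).
set L := [pred t | _] => cardL.
have [a aP] := dense_diagonal L.
set X' := [set t | _] in aP.
have X'P t : t \in X' -> \sum_x dev [ffun i => a i + t] x ^+ q <= 2 * (#|U|%:R * B).
  by rewrite inE => /andP[].
have X'card : (#|U| <= 2 ^ (s * k).+1 * #|X'|)%N.
  rewrite cA in cardL.
  have Ak : (0 < #|A| ^ k)%N by rewrite expn_gt0 A0.
  rewrite -(leq_pmul2r Ak).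
  have UA : (#|U| ^ k <= 2 ^ (s * k) * #|A| ^ k)%N.
    by rewrite expnM -expnMn leq_exp2r // muln_gt0 q0 expn_gt0 m0.
  have h1 : (#|U| * #|A| ^ k <= 2 * (#|U| * #|L|))%N by rewrite mulnCA leq_mul2l cardL orbT.
  apply: (leq_trans h1); rewrite expnS -!mulnA leq_mul2l /=.
  apply: (leq_trans aP).
  by rewrite [(#|X'| * _)%N]mulnC mulnA leq_mul2r UA orbT.
have /card_gt0P[t0 t0X] : (0 < #|X'|)%N.
  by have := leq_trans U0 X'card; rewrite muln_gt0 => /andP[].
have cX : #|[set t | t + t0 \in X']| = #|X'|.
  rewrite -[RHS](card_imset _ (addIr (- t0))); apply: eq_card => t.
  rewrite inE; apply/idP/imsetP => [tX|[u uX ->]]; last by rewrite subrK.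
  by exists (t + t0); rewrite // addrK.
exists [set t | t + t0 \in X']; rewrite cX; split=> //; first by apply/card_gt0P; exists t0.
move=> t; rewrite inE => tX.
have k0 : 0 < k%:R :> R by rewrite ltr0n muln_gt0 q0 expn_gt0 m0.
(* The two sample sums coincide, since (x + t) + (a i + t0) = x + (a i + (t + t0)); only the two
   deviations remain. *)
have devE x : k%:R * (f (x + t) - f x) =
    - dev [ffun i => a i + t0] (x + t) + dev [ffun i => a i + (t + t0)] x.
  rewrite /dev !sumrB !sumr_const card_ord -[f (x + t) *+ k]mulr_natl -[f x *+ k]mulr_natl.
  have -> : \sum_i (x + t + [ffun i => a i + t0] i \in S)%:R =
      \sum_i (x + [ffun i => a i + (t + t0)] i \in S)%:R :> R.
    by apply: eq_bigr => i _; rewrite !ffunE -!addrA [t + (a i + t0)]addrCA.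
  by rewrite opprB addrA subrK mulrBr.
have sum_le : \sum_x (k%:R * (f (x + t) - f x)) ^+ q <= 2 ^+ q * (2 * (#|U|%:R * B)).
  rewrite -(ler_pM2l (ltr0n _ 2)).
  have h x : 2 * (k%:R * (f (x + t) - f x)) ^+ q <=
     2 ^+ q * (dev [ffun i => a i + t0] (x + t) ^+ q + dev [ffun i => a i + (t + t0)] x ^+ q).
    rewrite devE; apply: (le_trans (expr_addr_le _ _ _)).
    by rewrite -/q exprNn -signr_odd (negbTE qe) mul1r.
  rewrite mulr_sumr; apply: (le_trans (ler_sum _ (fun x _ => h x))).
  rewrite -mulr_sumr mulrCA ler_wpM2l ?exprn_ge0 // big_split /=.
  have -> : \sum_x dev [ffun i => a i + t0] (x + t) ^+ q = \sum_x dev [ffun i => a i + t0] x ^+ q.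
    by rewrite [RHS](reindex_inj (addIr t)).
  by rewrite [leRHS]mulr_natl mulr2n lerD // X'P.
rewrite -(ler_pM2l (exprn_gt0 q k0)) mulr_sumr.
under eq_bigr => x _ do rewrite -exprMn.
apply: (le_trans sum_le).
rewrite [leRHS]mulrA -exprMn.
(* The two deviations give 32 q m inside the power. The 2 in [B] and the 2 of Markov's inequality
   leave a prefactor 4, absorbed by [4 <= 4 ^+ q]; this makes 128. *)
have -> : k%:R * (128 / m%:R) = 4 * (2 * (16 * q%:R * m%:R)) :> R.
  rewrite /k natrM natrX; field.
  by rewrite pnatr_eq0 -lt0n.
rewrite [X in _ <= X * _]exprMn [X in _ <= _ * X * _]exprMn.
have -> : 2 ^+ q * (2 * (#|U|%:R * B)) =
    4 * (2 ^+ q * (16 * q%:R * m%:R) ^+ q) * #|U|%:R :> R.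
  by rewrite /B; ring.
rewrite !ler_wpM2r // ?mulr_ge0 ?exprn_ge0 ?mulr_ge0 //.
by rewrite ler_eXnr // ler1n.
Qed.
End CrootSisask.

(** * The Bogolyubov-Ruzsa lemma *)

Section AverageNorms.
Context (R : realFieldType) (U : finZmodType).
Implicit Types (A X : {set U}) (f g : U -> R).

Lemma sum_translate f t : \sum_x f (x + t) = \sum_x f x.
Proof. by rewrite [RHS](reindex_inj (addIr t)). Qed.

Lemma average_expr_le X j g : (0 < #|X|)%N ->
  \sum_x average X g x ^+ (2 ^ j) <= \sum_x g x ^+ (2 ^ j).
Proof.
move=> X0.
apply: (le_trans (ler_sum _ (fun x _ => expr_mean_le j (fun t => g (x + t)) X0))).
rewrite -mulr_sumr exchange_big /=.
under eq_bigr => t _ do rewrite (sum_translate (fun x => g x ^+ (2 ^ j))).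
by rewrite sumr_const -[X in _ * X <= _]mulr_natl mulKf // pnatr_eq0 -lt0n.
Qed.

Lemma average_sub_expr_le X j f K : (0 < #|X|)%N ->
  (forall t, t \in X -> \sum_x (f (x + t) - f x) ^+ (2 ^ j) <= K) ->
  \sum_x (average X f x - f x) ^+ (2 ^ j) <= K.
Proof.
move=> X0 fK; have X0' : #|X|%:R != 0 :> R by rewrite pnatr_eq0 -lt0n.
have E x : average X f x - f x = #|X|%:R^-1 * \sum_(t in X) (f (x + t) - f x).
  by rewrite sumrB sumr_const mulrBr -[f x *+ _]mulr_natl mulKf.
under eq_bigr => x _ do rewrite E.
apply: (le_trans (ler_sum _ (fun x _ => expr_mean_le j (fun t => f (x + t) - f x) X0))).
rewrite -mulr_sumr exchange_big /= ler_pdivrMl ?ltr0n //.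
by apply: (le_trans (ler_sum _ fK)); rewrite sumr_const -[leLHS]mulr_natl.
Qed.

(** Telescoping: each increment [F i] is the average over [X] of the previous one, and averaging
    does not increase the moment. The factor [l%:R ^+ (2 ^ j)] is the triangle inequality for [l]
    increments. *)
Lemma iter_average_sub_expr_le X j l f K : (0 < #|X|)%N ->
  (forall t, t \in X -> \sum_x (f (x + t) - f x) ^+ (2 ^ j) <= K) ->
  \sum_x (iter l (average X) f x - f x) ^+ (2 ^ j) <= l%:R ^+ (2 ^ j) * K.
Proof.
move=> X0 fK.
pose F i x := iter i.+1 (average X) f x - iter i (average X) f x.
have FK i : \sum_x F i x ^+ (2 ^ j) <= K.
  elim: i => [|i IHi]; first exact: average_sub_expr_le.
  apply: le_trans IHi.
  have E x : F i.+1 x = average X (F i) x.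
    by rewrite /F /= /average sumrB mulrBr.
  under eq_bigr => x _ do rewrite E.
  exact: average_expr_le.
have E x : iter l (average X) f x - f x = \sum_(i < l) F i x.
  by rewrite -(big_mkord xpredT (fun i => F i x)) telescope_sumr.
case: l E => [|l] E.
  rewrite big1 => [|x _]; last by rewrite E big_ord0 expr0n expn_eq0.
  by rewrite expr0n expn_eq0 mul0r.
have l0 : 0 < l.+1%:R :> R by rewrite ltr0n.
rewrite -(ler_pM2l l0) mulr_sumr.
have h x : l.+1%:R * (iter l.+1 (average X) f x - f x) ^+ (2 ^ j) <=
    l.+1%:R ^+ (2 ^ j) * \sum_(i < l.+1) F i x ^+ (2 ^ j).
  by rewrite E; have := @expr_sum_le R 'I_l.+1 predT j (fun i => F i x); rewrite card_ord.
apply: (le_trans (ler_sum _ (fun x _ => h x))).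
rewrite -mulr_sumr mulrCA ler_wpM2l ?exprn_ge0 // exchange_big /=.
apply: (le_trans (ler_sum _ (fun (i : 'I_l.+1) _ => FK i))).
by rewrite sumr_const card_ord -[leLHS]mulr_natl.
Qed.

(** Restricting from [U] to [A] costs the inverse density, at most [2 ^ s]. As [s <= 2 ^ j], this is
    only a factor 2 after the root of order [2 ^ j] is taken. *)
Lemma mean_le_of_moment A s j g (eps : R) :
  (0 < #|A|)%N -> (#|U| <= 2 ^ s * #|A|)%N -> (s <= 2 ^ j)%N -> 0 <= eps -> (0 < j)%N ->
  \sum_x g x ^+ (2 ^ j) <= eps ^+ (2 ^ j) * #|U|%:R ->
  `|\sum_(x in A) g x| <= 2 * eps * #|A|%:R.
Proof.
move=> A0 AU sj eps0 j0 gle.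
have A0' : 0 < #|A|%:R :> R by rewrite ltr0n.
rewrite -ler_pdivrMr // mulrC -[X in X * _]ger0_norm ?invr_ge0 // -normrM.
have q0 : (0 < 2 ^ j)%N by rewrite expn_gt0.
rewrite -(ler_pXn2r q0) ?nnegrE // ?mulr_ge0 //.
have qe : ~~ odd (2 ^ j) by rewrite oddX orbF -lt0n.
rewrite -normrX ger0_norm; last by rewrite real_exprn_even_ge0 // num_real.
apply: (le_trans (expr_mean_le _ _ A0)).
rewrite ler_pdivrMl // exprMn.
apply: (@le_trans _ _ (\sum_x g x ^+ (2 ^ j))).
  rewrite [leRHS](bigID (mem A)) /= lerDl sumr_ge0 // => x _.
  by rewrite real_exprn_even_ge0 // num_real.
apply: (le_trans gle).
rewrite [leRHS]mulrCA [leRHS]mulrA [leLHS]mulrC ler_wpM2r ?exprn_ge0 //.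
apply: (@le_trans _ _ ((2 ^ s * #|A|)%N%:R)); first by rewrite ler_nat.
by rewrite natrM natrX ler_wpM2r // ler_weXn2l // ler1n.
Qed.
End AverageNorms.

Lemma average_real_complex (R : rcfType) (U : finZmodType) (X : {pred U}) (f : U -> R) x :
  average X (fun x => (f x)%:C)%C x = ((average X f x)%:C)%C.
Proof.
rewrite /average rmorphM fmorphV rmorph_nat rmorph_sum; done.
Qed.

Lemma iter_average_real_complex (R : rcfType) (U : finZmodType) (X : {pred U}) l (f : U -> R) x :
  iter l (average X) (fun x => (f x)%:C)%C x = ((iter l (average X) f x)%:C)%C.
Proof.
elim: l x => // l IHl x; rewrite !iterS -average_real_complex.
by rewrite /average; congr (_ * _); apply: eq_bigr => t _; rewrite IHl.
Qed.

Lemma eq_iter_average (K : fieldType) (U : finZmodType) (X : {pred U}) l (f g : U -> K) :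
  f =1 g -> iter l (average X) f =1 iter l (average X) g.
Proof.
move=> fg; elim: l => // l IHl x; rewrite !iterS.
by rewrite /average; congr (_ * _); apply: eq_bigr => t _; rewrite IHl.
Qed.

Lemma smoothing_real_le (R : realType) p (e : 'F_p -> R[i]) n (X : {pred 'rV['F_p]_n})
    (V : {vspace 'rV['F_p]_n}) l (f g : 'rV['F_p]_n -> R) :
  additive_character e ->
  (forall y, 2^-1 <= `|character_mean e X y| -> forall v, v \in V -> dot y v = 0) ->
  `|\sum_x (iter l (average X) f x - iter l (average X) (average V f) x) * g x|
    <= 2^-1 ^+ l * (2^-1 * (\sum_x f x ^+ 2 + \sum_x g x ^+ 2)).
Proof.
move=> eP specV.
have := smoothing_le eP l (fun x => (f x)%:C)%C (fun x => (g x)%:C)%C specV.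
have -> : \sum_x (iter l (average X) (fun x => (f x)%:C)%C x -
     iter l (average X) (average V (fun x => (f x)%:C)%C) x) * ((g x)%:C)%C^* =
   ((\sum_x (iter l (average X) f x - iter l (average X) (average V f) x) * g x)%:C)%C.
  rewrite rmorph_sum; apply: eq_bigr => x _; rewrite rmorphM rmorphB /=.
  rewrite iter_average_real_complex; congr ((_ - _) * _).
    by rewrite (eq_iter_average _ _ (average_real_complex V f)) iter_average_real_complex.
  by rewrite conj_Creal // complex_real.
have E (h : 'rV['F_p]_n -> R) : \sum_x `|(h x)%:C%C| ^+ 2 = ((\sum_x h x ^+ 2)%:C)%C.
  rewrite rmorph_sum; apply: eq_bigr => x _.
  by rewrite -add_Re2_Im2 /= expr0n addr0.
rewrite !E -rmorphD /=.
have E2 : 2^-1 = (2^-1 : R)%:C%C by rewrite fmorphV rmorph_nat.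
rewrite E2 -rmorphM -rmorphXn -rmorphM.
have -> (z : R) : `|z%:C%C| = (`|z|)%:C%C.
  by rewrite normc_def /= expr0n addr0 sqrtr_sqr.
by rewrite lecR.
Qed.

Lemma trunc_log_double s : (0 < s)%N ->
  (s <= 2 ^ (trunc_log 2 s).+1)%N /\ (2 ^ (trunc_log 2 s).+1 <= 2 * s)%N.
Proof.
move=> s0; split; first exact/ltnW/trunc_log_ltn.
by rewrite expnS leq_mul2l trunc_logP.
Qed.

(** The trace [T] of [S] on the coset, moved into [V], and its translate by [v] each fill more than
    half of [V], so they meet. *)
Lemma sumset_dense_coset (R : realFieldType) p n (V : {vspace 'rV['F_p]_n})
    (S : {pred 'rV['F_p]_n}) z v :
  2^-1 < average V (fun x => (x \in S)%:R : R) z -> v \in V ->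
  exists x y, [/\ x \in S, y \in S & v = x - y].
Proof.
rewrite /average => h vV.
pose T := [set w in V | z + w \in S].
have cT : (#|V| < 2 * #|T|)%N.
  have V0 : (0 < #|V|)%N by apply/card_gt0P; exists 0; apply: mem0v.
  have -> : #|T| = (\sum_(t in V) ((z + t)%R \in S))%N.
    rewrite -sum1_card big_mkcond [RHS]big_mkcond /=; apply: eq_bigr => w _.
    by rewrite inE; case: (w \in V) => //=; case: (_ \in S).
  rewrite -(ltr_nat R) natrM natr_sum -ltr_pdivrMl ?ltr0n //.
  by move: h; rewrite mulrC ltr_pdivlMr ?ltr0n.
pose T' := [set w + v | w in T].
have cT' : #|T'| = #|T| by rewrite card_imset //; apply: addIr.
have TV : T :|: T' \subset [set w in V].
  apply/subsetP => w; rewrite !inE => /orP[/andP[]//|/imsetP[w']].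
  by rewrite inE => /andP[w'V _] ->; rewrite memvD.
have : T :&: T' != set0.
  apply/negP => /eqP dis; move: (subset_leq_card TV).
  rewrite cardsU dis cards0 subn0 cT' addnn -mul2n [X in (_ <= X)%N]cardsE.
  by apply/negP; rewrite -ltnNge.
case/set0Pn => w; rewrite !inE => /andP[/andP[wV wS] /imsetP[w']].
rewrite inE => /andP[w'V w'S] wE; exists (z + w), (z + w'); split => //.
by rewrite wE opprD addrACA subrr add0r addrAC subrr add0r.
Qed.

Lemma average_le (R : realFieldType) (U : finZmodType) (X : {pred U}) (f : U -> R) c :
  (0 < #|X|)%N -> (forall x, f x <= c) -> forall x, average X f x <= c.
Proof.
move=> X0 fc x; rewrite /average ler_pdivrMl ?ltr0n //.
apply: (le_trans (ler_sum _ (fun t _ => fc (x + t)))).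
by rewrite sumr_const -[leLHS]mulr_natl.
Qed.

Lemma average_ge0 (R : realFieldType) (U : finZmodType) (X : {pred U}) (f : U -> R) :
  (forall x, 0 <= f x) -> forall x, 0 <= average X f x.
Proof. by move=> f0 x; rewrite /average mulr_ge0 ?invr_ge0 ?sumr_ge0. Qed.

Lemma averageC (K : fieldType) (U : finZmodType) (X Y : {pred U}) (f : U -> K) x :
  average X (average Y f) x = average Y (average X f) x.
Proof.
rewrite /average -!mulr_sumr mulrCA; congr (_ * (_ * _)).
rewrite exchange_big /=; apply: eq_bigr => t _; apply: eq_bigr => u _.
by rewrite addrAC.
Qed.

Lemma iter_average_le (R : realFieldType) (U : finZmodType) (X : {pred U}) l (f : U -> R) c :
  (0 < #|X|)%N -> (forall x, f x <= c) -> forall x, iter l (average X) f x <= c.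
Proof. by move=> X0 fc; elim: l => // l IHl; apply: average_le. Qed.

(* The mean f(x) of the indicator of A + A over x + A is 1 on A. Averaging f
   repeatedly over the almost periods X, and then over the annihilator V of the
   large spectrum of X, barely changes its mean on A, so A + A fills more than
   half of some coset of V. *)
Lemma quasipolynomial_bogolyubov (R : realType) p : prime p ->
  exists c : nat, forall n s (A : {set 'rV['F_p]_n}),
    (0 < s)%N -> (#|{: 'rV['F_p]_n}| <= 2 ^ s * #|A|)%N ->
  exists V : {vspace 'rV['F_p]_n},
    (#|{: 'rV['F_p]_n}| <= #|V| * p ^ (c * s ^ 4))%N /\
    forall v, v \in V -> exists a1 a2 a3 a4,
      [/\ a1 \in A, a2 \in A, a3 \in A, a4 \in A & v = a1 + a2 - (a3 + a4)].
Proof.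
(* Here 2^33 = 32 * 2 * 2^27: 32 from Chang's theorem, 2^27 s^4 as a bound for s 2^j m^2 (from
   [2 ^ j <= 2 * s] and [l <= 4 * s]), and 2 for the successor in the density of [X]. *)
move=> p_pr; exists (2 ^ 33)%N => n s A s0 AU.
have [e eP] := additive_character_exists R[i] p_pr.
have U0 : (0 < #|{: 'rV['F_p]_n}|)%N by apply/card_gt0P; exists 0.
have A0 : (0 < #|A|)%N by have := leq_trans U0 AU; rewrite muln_gt0 => /andP[].
have [sj js] := trunc_log_double s0.
set j := (trunc_log 2 s).+1 in sj js.
(* Both errors become 1/8 of [#|A|]: smoothing loses 2^(-l) 2^s = 1/8, and [l] averagings with
   precision 128/m lose 2 l (128/m) = 1/8. *)
pose l := (s + 3)%N; pose m := (2 ^ 11 * l)%N.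
have l0 : (0 < l)%N by rewrite addn_gt0 s0.
have m1 : (1 < m)%N.
  by rewrite /m expnS -mulnA leq_pmulr // muln_gt0 expn_gt0.
pose S : {pred 'rV['F_p]_n} := [pred x | [exists a in A, exists b in A, x == a + b]].
pose ind (x : 'rV['F_p]_n) : R := (x \in S)%:R.
pose f := average A ind.
have [X [X0 XU Xf]] := croot_sisask R S (ltn0Sn _ : (0 < j)%N) m1 A0 AU.
have [V [specV cV]] := large_spectrum_annihilator p_pr eP X0 XU.
have V0 : (0 < #|V|)%N by apply/card_gt0P; exists 0; apply: mem0v.
exists V; split.
  apply: (leq_trans cV); rewrite leq_mul2l; apply/orP; right.
  rewrite leq_pexp2l ?prime_gt0 //.
  have l4 : (l <= 4 * s)%N by rewrite /l; lia.
  have h1 : (2 ^ j * m ^ 2 <= 2 * s * (2 ^ 11 * (4 * s)) ^ 2)%N.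
    by rewrite leq_mul // leq_exp2r // leq_mul.
  have h2 : (s * (2 ^ j * m ^ 2) <= 2 ^ 27 * s ^ 4)%N.
    apply: (@leq_trans (s * (2 * s * (2 ^ 11 * (4 * s)) ^ 2))); first by rewrite leq_mul2l h1 orbT.
    have -> : (27 = 1 + 11 * 2 + 2 * 2)%N by [].
    rewrite !expnD !expnM !expnMn -/(2 ^ 2)%N leq_eqVlt; apply/orP; left; apply/eqP.
    by move: (2 ^ 11)%N => P; ring.
  have h3 : (0 < 2 ^ 27 * s ^ 4)%N by rewrite muln_gt0 !expn_gt0 s0.
  have -> : (33 = 6 + 27)%N by [].
  by rewrite expnD -mulnA; move: (2 ^ 27 * s ^ 4)%N h2 h3 => P; lia.
pose g (x : 'rV['F_p]_n) : R := (x \in A)%:R.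
have sum_g (h : 'rV['F_p]_n -> R) : \sum_x h x * g x = \sum_(x in A) h x.
  rewrite [RHS]big_mkcond; apply: eq_bigr => x _; rewrite /g.
  by case: (x \in A); rewrite ?mulr1 ?mulr0.
have ind01 x : 0 <= ind x <= 1 by rewrite /ind; case: (x \in S); rewrite /= ?lexx ?ler01.
have f0 x : 0 <= f x by apply: average_ge0 => y; case/andP: (ind01 y).
have f1 x : f x <= 1 by apply: average_le => // y; case/andP: (ind01 y).
have fA a : a \in A -> f a = 1.
  move=> aA; rewrite /f /average (eq_bigr (fun=> 1)) => [|b bA].
    by rewrite sumr_const mulVf // pnatr_eq0 -lt0n.
  rewrite /ind (_ : _ \in S) // inE; apply/existsP; exists a; rewrite aA /=.
  by apply/existsP; exists b; rewrite bA eqxx.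
have A0' : 0 < #|A|%:R :> R by rewrite ltr0n.
have l0' : 0 < l%:R :> R by rewrite ltr0n.
have step1 : `|\sum_(a in A) (iter l (average X) f a - f a)| <= 8^-1 * #|A|%:R.
  have := iter_average_sub_expr_le l X0 Xf.
  rewrite mulrA -exprMn => /(mean_le_of_moment A0 AU sj _ (ltn0Sn _)).
  move=> /(_ _)/le_trans; apply.
    by rewrite mulr_ge0 // divr_ge0.
  rewrite ler_wpM2r // le_eqVlt; apply/orP; left; apply/eqP.
  rewrite /m natrM natrX; field.
  exact: lt0r_neq0.
have step2 : `|\sum_(a in A) (iter l (average X) f a - iter l (average X) (average V f) a)|
    <= 8^-1 * #|A|%:R.
  have := smoothing_real_le l f g eP specV; rewrite sum_g => /le_trans; apply.
  have fN : \sum_x f x ^+ 2 <= #|{: 'rV['F_p]_n}|%:R.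
    rewrite -[leRHS]sumr_const; apply: ler_sum => x _; exact: exprn_ile1.
  have gN : \sum_x g x ^+ 2 <= #|{: 'rV['F_p]_n}|%:R.
    rewrite -[leRHS]sumr_const; apply: ler_sum => x _; rewrite /g.
    by case: (x \in A); rewrite ?expr1n ?expr0n.
  have AU' : #|{: 'rV['F_p]_n}|%:R <= 2 ^+ s * #|A|%:R :> R.
    by rewrite -natrX -natrM ler_nat.
  apply: (@le_trans _ _ (2^-1 ^+ l * (2 ^+ s * #|A|%:R))).
    rewrite ler_wpM2l ?exprn_ge0 ?invr_ge0 // ler_pdivrMl //.
    rewrite mulr_natl mulr2n; apply: lerD; exact: le_trans AU'.
  rewrite /l exprD [X in X * _]mulrC -mulrA [X in _ * X]mulrA -(exprMn s) mulVf ?pnatr_eq0 //.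
  by rewrite expr1n mul1r ler_wpM2r // exprVn -natrX.
have [/existsP[z zP]|] := boolP [exists z, 2^-1 < average V ind z].
  move=> v vV; have [x [y [xS yS ->]]] := sumset_dense_coset zP vV.
  move: xS yS; rewrite !inE => /existsP[a1 /andP[a1A /existsP[a2 /andP[a2A /eqP->]]]].
  move=> /existsP[a3 /andP[a3A /existsP[a4 /andP[a4A /eqP->]]]].
  by exists a1, a2, a3, a4.
rewrite negb_exists => /forallP noz.
have half z : average V ind z <= 2^-1 by rewrite leNgt; apply: noz.
(* Averaging over [V] commutes with averaging over [A]. With no coset more than half full, the mean
   of [f] on [A], which is 1, would be at most 1/2 + 1/8 + 1/8. *)
have Vf x : average V f x <= 2^-1 by rewrite averageC; apply: average_le.
have := iter_average_le l X0 Vf => TVf.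
exfalso.
have sTV : \sum_(a in A) iter l (average X) (average V f) a <= #|A|%:R * 2^-1.
  by apply: (le_trans (ler_sum _ (fun a _ => TVf a))); rewrite sumr_const -[leLHS]mulr_natl.
have sf : \sum_(a in A) f a = #|A|%:R.
  by rewrite (eq_bigr (fun=> 1)) ?sumr_const.
move: step1 step2; rewrite !sumrB sf !ler_norml => /andP[h1 _] /andP[_ h2].
move: h1 h2 sTV A0'; clear; set x := \sum_(a in A) _; set y := \sum_(a in A) _.
move: (#|A|%:R : R) x y => N x y; lra.
Qed.

(** * Subspaces in a doubling tower *)

(** Over the prime field scalars are residues of natural numbers, so scaling is repeated
    addition. *)
Lemma vspace_of_addr_closed p n (S : {set 'rV['F_p]_n}) :
  0 \in S -> {in S &, forall x y, x + y \in S} ->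
  exists V : {vspace 'rV['F_p]_n}, forall x, (x \in V) = (x \in S).
Proof.
move=> S0 SD.
have SM x k : x \in S -> x *+ k \in S.
  move=> xS; elim: k => [|k IHk]; first by rewrite mulr0n.
  by rewrite mulrS SD.
exists <<enum S>>%VS => x; apply/idP/idP => [xV|xS]; last first.
  by apply: memv_span; rewrite mem_enum.
rewrite (coord_span (X := in_tuple (enum S)) xV).
apply: (big_ind (fun y => y \in S)) => // i _.
rewrite -[coord _ _ _]natr_Zp scaler_nat SM // -mem_enum.
by rewrite mem_nth // size_tuple.
Qed.

Lemma maximal_avoiding_subspace (F : finFieldType) (U : vectType F) (P : pred {vspace U}) Z0 :
  P Z0 -> exists2 Z, P Z & forall x, x \notin Z -> ~~ P (Z + <[x]>)%VS.
Proof.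
have [k] := ubnP (dim U - \dim Z0); elim: k Z0 => // k IHk Z0 lek PZ0.
have [[x [xZ Px]]|nox] := boolp.pselect (exists x, x \notin Z0 /\ P (Z0 + <[x]>)%VS).
  apply: (IHk (Z0 + <[x]>)%VS) => //.
  have lt : (\dim Z0 < \dim (Z0 + <[x]>))%N.
    rewrite ltn_neqAle dimvS ?addvSl // andbT.
    apply: contra xZ => /eqP dE.
    have /eqP -> : Z0 == (Z0 + <[x]>)%VS by rewrite eqEdim addvSl dE leqnn.
    by rewrite memvE addvSr.
  have := dimvS (subvf (Z0 + <[x]>)%VS); rewrite dimvf => le.
  by rewrite ltnS in lek; apply: leq_trans lek; apply: ltn_sub2l; rewrite // (leq_trans lt).
by exists Z0 => // x xZ; apply/negP => Px; apply: nox; exists x.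
Qed.

(** Why level 4: with A = B 0 + Z, elements of A + A - A - A have the form b + z with b in [B 2].
    The sum of two such b lies in [B 3], and subtracting a third lands in [B 4], where [Z] is
    trivial. Hence the [B 2]-components of [V] are closed under addition. Passing to [A] and back
    multiplies and divides cardinalities by [#|Z|]. *)
Lemma subspace_in_tower (R : realType) p : prime p ->
  exists c : nat, forall n s (B : nat -> {set 'rV['F_p]_n}),
    (forall i, 0 \in B i) -> (forall i x, x \in B i -> - x \in B i) ->
    (forall i x y, x \in B i -> y \in B i -> x + y \in B i.+1) ->
    (#|B 4| <= 2 ^ s * #|B 0|)%N ->
  exists V : {vspace 'rV['F_p]_n},
    {subset V <= B 2} /\ (#|B 0| <= #|V| * p ^ (c * (s + p) ^ 4))%N.
Proof.
move=> p_pr; have [c bogo] := quasipolynomial_bogolyubov R p_pr.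
exists c => n s B B0 BN BD B40.
have BS i x : x \in B i -> x \in B i.+1 by move=> xB; rewrite -[x]addr0 BD.
have BB i x y : x \in B i -> y \in B i -> x - y \in B i.+1.
  by move=> xB yB; apply: BD => //; apply: BN.
pose P (Z : {vspace 'rV['F_p]_n}) := [forall x in Z, (x \in B 4) ==> (x == 0)].
have P0 : P 0%VS by apply/forall_inP => x; rewrite memv0 => /eqP->; rewrite eqxx implybT.
have [Z PZ maxZ] := maximal_avoiding_subspace P0.
have ZB x : x \in Z -> x \in B 4%N -> x = 0.
  by move=> xZ xB; have /forall_inP/(_ _ xZ) := PZ; rewrite xB => /eqP.
pose A := [set b.1 + b.2 | b in setX (B 0%N) [set z in Z]].
have cA : #|A| = (#|B 0%N| * #|Z|)%N.
  rewrite card_in_imset ?cardsX ?[X in (_ * X)%N]cardsE // => -[b z] [b' z'].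
  rewrite !inE /= => /andP[bB zZ] /andP[b'B z'Z] E.
  have bz : b - b' = z' - z.
    have -> : b = b' + z' - z by rewrite -E addrK.
    by rewrite addrAC [b' + z']addrC addrK.
  have b0 : b - b' = 0.
    apply: ZB; first by rewrite bz memvB.
    by apply/BS/BS/BS/BB.
  move: bz E; rewrite b0 => /esym/eqP; rewrite subr_eq0 => /eqP->.
  by move/eqP: b0; rewrite subr_eq0 => /eqP->.
(* By maximality, adjoining any x outside [Z] produces a nonzero w = z + a x in [B 4], with a
   nonzero. So x lies in a^(-1) w + Z, and the scalar multiples of [B 4] together with [Z] cover the
   space. The factor [p] is later bounded by [2 ^ p], hence [s + p]. *)
have cU : (#|{: 'rV['F_p]_n}| <= p * (#|B 4%N| * #|Z|))%N.
  pose h (t : 'F_p * ('rV['F_p]_n * 'rV['F_p]_n)) := t.1 *: t.2.1 + t.2.2.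
  pose D := setX [set: 'F_p] (setX (B 4%N) [set z in Z]).
  have -> : (p * (#|B 4%N| * #|Z|))%N = #|D|.
    by rewrite !cardsX cardsT (card_Fp p_pr) [in RHS]cardsE.
  apply: leq_trans (leq_imset_card h D); apply/subset_leq_card/subsetP => x _.
  apply/imsetP; have [xZ|xZ] := boolP (x \in Z).
    by exists (0, (0, x)); rewrite ?inE /= ?B0 //= /h scale0r add0r.
  have := maxZ x xZ; rewrite negb_forall_in => /exists_inP[w].
  move=> /memv_addP[z zZ [_ /vlineP[a ->] ->]]; rewrite negb_imply => /andP[wB w0].
  have a0 : a != 0.
    apply: contra w0 => /eqP a0; move: wB; rewrite a0 scale0r addr0 => zB.
    by apply/eqP; apply: ZB.
  exists (a^-1, (z + a *: x, - (a^-1 *: z))); first by rewrite !inE /= wB memvN memvZ.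
  by rewrite /h /= scalerDr scalerA mulVf // scale1r addrAC subrr add0r.
have AU : (#|{: 'rV['F_p]_n}| <= 2 ^ (s + p) * #|A|)%N.
  apply: (leq_trans cU); rewrite cA expnD mulnA.
  rewrite [X in (_ <= X)%N]mulnA leq_mul2r; apply/orP; right.
  have h1 : (p <= 2 ^ p)%N by rewrite ltnW // ltn_expl.
  by rewrite [(2 ^ s * _)%N]mulnC -mulnA leq_mul.
have sp : (0 < s + p)%N by rewrite addn_gt0 (prime_gt0 p_pr) orbT.
have [V [cV VA]] := bogo n _ A sp AU.
pose S := [set b in B 2 | [exists z in Z, b + z \in V]].
have VBZ v : v \in V -> exists2 b, b \in B 2 & exists2 z, z \in Z & v = b + z.
  move=> /VA[a1 [a2 [a3 [a4 [/imsetP[[b1 z1] + ->] /imsetP[[b2 z2] + ->]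
     /imsetP[[b3 z3] + ->] /imsetP[[b4 z4] + ->] ->]]]]].
  rewrite !inE /= => /andP[b1B z1Z] /andP[b2B z2Z] /andP[b3B z3Z] /andP[b4B z4Z].
  exists (b1 + b2 - (b3 + b4)); first by apply: BB; apply: BD.
  exists (z1 + z2 - (z3 + z4)); first by rewrite memvB ?memvD.
  by rewrite [b1 + z1 + _]addrACA [b3 + z3 + _]addrACA [X in _ + X]opprD [LHS]addrACA.
have S0 : 0 \in S.
  by rewrite inE B0; apply/exists_inP; exists 0; rewrite ?addr0 mem0v.
have SD : {in S &, forall x y, x + y \in S}.
  move=> x y; rewrite !inE => /andP[xB /exists_inP[z zZ xz]] /andP[yB /exists_inP[z' z'Z yz]].
  have xyV : (x + y) + (z + z') \in V by rewrite addrACA memvD.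
  have [b bB [u uZ E]] := VBZ _ xyV.
  have xyb : x + y - b = u - (z + z').
    by apply/eqP; rewrite subr_eq addrAC eq_sym subr_eq E addrC.
  have xyE : x + y = b.
    apply/eqP; rewrite -subr_eq0; apply/eqP; apply: ZB.
      by rewrite xyb memvB // memvD.
    by apply: BB; [apply: BD | apply: BS].
  rewrite {1}xyE bB /=; apply/exists_inP; exists (z + z') => //.
  by rewrite memvD.
have [V' V'S] := vspace_of_addr_closed S0 SD.
exists V'; split; first by move=> x; rewrite V'S inE => /andP[].
have Z0 : (0 < #|Z|)%N by apply/card_gt0P; exists 0; apply: mem0v.
have VV' : (#|V| <= #|V'| * #|Z|)%N.
  have -> : (#|V'| * #|Z| = #|setX S [set z in Z]|)%N.
    have cZ : #|[set z in Z]| = #|Z| by apply: eq_card => z; rewrite inE.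
    by rewrite cardsX cZ; congr (_ * _)%N; apply: eq_card => x; rewrite V'S.
  apply: leq_trans (leq_imset_card (fun b => b.1 + b.2) _).
  apply/subset_leq_card/subsetP => v vV.
  have [b bB [z zZ E]] := VBZ _ vV; apply/imsetP; exists (b, z) => //.
  by rewrite !inE bB zZ !andbT; apply/exists_inP; exists z; rewrite // -E.
rewrite -(leq_pmul2r Z0) -cA.
apply: (leq_trans (max_card _)); apply: (leq_trans cV).
by rewrite mulnAC leq_mul2r VV' orbT.
Qed.

(** * Shattering and packing *)

(** Induction on the points, through Pascal's rule. [J0 ++ D] has one index per trace on [vs]; [C]
    has one for each trace realised with both values at [v], so [v] can be added to any set that [C]
    shatters. *)
Lemma sauer_shelah (I V : eqType) (E : I -> V -> bool) (vs : seq V) k (J : seq I) :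
  uniq J ->
  {in J &, injective (fun i => [seq E i v | v <- vs])} ->
  (\sum_(i < k) 'C(size vs, i) < size J)%N ->
  exists t : seq V, [/\ size t = k, {subset t <= vs}
    & forall b : seq bool, size b = k -> exists2 i, i \in J & [seq E i v | v <- t] = b].
Proof.
elim: vs k J => [|v vs IHvs] [|k] J uJ injJ ltJ.
- exists [::]; split=> // b /size0nil->.
  by case: J ltJ {uJ injJ} => // i J _; exists i; rewrite ?mem_head.
- case: J uJ injJ ltJ => [|i [|j J]] /= uJ injJ; rewrite big_ord_recl ?bin0 //=.
  by move: uJ; rewrite (injJ i j) ?inE ?eqxx ?orbT.
- exists [::]; split=> // b /size0nil->.
  by case: J ltJ {uJ injJ} => // i J _; exists i; rewrite ?mem_head.
pose tr i := [seq E i w | w <- vs].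
pose J0 := [seq i <- J | ~~ E i v]; pose J1 := [seq i <- J | E i v].
pose T0 := [seq tr i | i <- J0].
pose C := [seq i <- J1 | tr i \in T0]; pose D := [seq i <- J1 | tr i \notin T0].
have sJ : (size J = size (J0 ++ D) + size C)%N.
  rewrite size_cat -addnA [(size D + _)%N]addnC -(count_predC (fun i => E i v) J) addnC.
  rewrite -!size_filter; congr (_ + _)%N.
  by rewrite -[LHS](count_predC (fun i => tr i \in T0)) -!size_filter.
have subC : {subset C <= J} by move=> i; rewrite !mem_filter => /and3P[].
have subD : {subset D <= J} by move=> i; rewrite !mem_filter => /and3P[].
have sub0 : {subset J0 <= J} by move=> i; rewrite !mem_filter => /andP[].
have tr_inj i j : i \in J -> j \in J -> E i v = E j v -> tr i = tr j -> i = j.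
  by move=> iJ jJ Ev trE; apply: injJ; rewrite //= Ev; congr (_ :: _).
have sumE : (\sum_(i < k.+1) 'C(size (v :: vs), i) =
    \sum_(i < k.+1) 'C(size vs, i) + \sum_(i < k) 'C(size vs, i))%N.
  by rewrite !big_ord_recl !bin0 -addnA -big_split /=; congr (_ + _)%N.
rewrite sumE sJ in ltJ.
have [ltU|leU] := ltnP (\sum_(i < k.+1) 'C(size vs, i)) (size (J0 ++ D)).
  have uU : uniq (J0 ++ D).
    rewrite cat_uniq !filter_uniq //= andbT; apply/hasPn => i.
    by rewrite !mem_filter => /and3P[_ ->].
  have injU : {in J0 ++ D &, injective tr}.
    have inj0D i j : i \in J0 -> j \in D -> tr i <> tr j.
      move=> i0; rewrite mem_filter => /andP[/negP jT0 _] trE; apply: jT0.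
      by rewrite -trE map_f.
    move=> i j; rewrite !mem_cat => /orP[i0|iD] /orP[j0|jD] trE.
    - apply: tr_inj trE; rewrite ?sub0 //.
      by move: i0 j0; rewrite !mem_filter => /andP[/negbTE-> _] /andP[/negbTE-> _].
    - by case: (inj0D _ _ i0 jD).
    - by case: (inj0D _ _ j0 iD).
    apply: tr_inj trE; rewrite ?subD //.
    by move: iD jD; rewrite !mem_filter => /and3P[_ -> _] /and3P[_ -> _].
  have [t [st tvs tP]] := IHvs _ _ uU injU ltU.
  exists t; split=> // [w /tvs wvs|b /tP[i iU <-]]; first by rewrite inE wvs orbT.
  by exists i => //; move: iU; rewrite mem_cat => /orP[/sub0|/subD].
have ltC : (\sum_(i < k) 'C(size vs, i) < size C)%N.
  by rewrite -(ltn_add2l (\sum_(i < k.+1) 'C(size vs, i))) (leq_trans ltJ) // leq_add2r.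
have uC : uniq C by rewrite !filter_uniq.
have injC : {in C &, injective tr}.
  move=> i j iC jC trE; apply: tr_inj trE; rewrite ?subC //.
  by move: iC jC; rewrite !mem_filter => /and3P[_ -> _] /and3P[_ -> _].
have [t [st tvs tP]] := IHvs _ _ uC injC ltC.
exists (v :: t); split=> [|w|[//|c b] [sb]]; first by rewrite /= st.
  by rewrite !inE => /orP[->|/tvs->]; rewrite ?orbT.
have [i iC trb] := tP b sb.
have := iC; rewrite mem_filter => /andP[/mapP[j j0 trE]]; rewrite mem_filter => /andP[iv iJ].
case: c.
  by exists i => //=; rewrite iv trb.
exists j; first exact: sub0.
move: j0; rewrite mem_filter => /andP[/negbTE jv _]; rewrite /= jv -trb; congr (_ :: _).
apply/eq_in_map => w /tvs wvs.
by move/eq_in_map: trE => /(_ _ wvs).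
Qed.

Lemma leq_bin_exp m k : ('C(m, k) <= m ^ k)%N.
Proof.
apply: (@leq_trans (m ^_ k)); first by rewrite -bin_ffact leq_pmulr // fact_gt0.
elim: k m => [|k IHk] m; first by rewrite ffactn0.
rewrite ffactnS expnS leq_mul2l; apply/orP; right; apply: (leq_trans (IHk _)).
by case: k {IHk} => // k; rewrite leq_exp2r // leq_pred.
Qed.

Lemma sum_bin_le m k : (\sum_(i < k.+1) 'C(m, i) <= m.+1 ^ k)%N.
Proof.
elim: k => [|k IHk]; first by rewrite big_ord_recl big_ord0 bin0.
rewrite big_ord_recr /=; apply: (leq_trans (leq_add IHk (leq_bin_exp m k.+1))).
rewrite [X in (_ <= X)%N]expnS mulSn leq_add2l expnS leq_mul2l.
by case: k {IHk} => [|k]; rewrite ?orbT // leq_exp2r ?leqnSn ?orbT.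
Qed.

(** Double counting yields a point separating a proportion [c] of the surviving pairs. That every
    chosen point separates some pair of [P] lets [packing_le] recover that it avoids the error
    class. *)
Lemma greedy_separation (R : realFieldType) (Q V : finType) (sep : Q -> V -> bool) (c : R)
    (P : {set Q}) m :
  0 < c <= 1 -> (0 < #|V|)%N ->
  (forall q, q \in P -> c * #|V|%:R <= #|[set v | sep q v]|%:R) ->
  exists vs : seq V,
    [/\ (size vs <= m)%N, forall v, v \in vs -> exists2 q, q \in P & sep q v
      & #|[set q in P | ~~ has (sep q) vs]|%:R <= (1 - c) ^+ m * #|P|%:R].
Proof.
move=> /andP[c0 c1] V0 sepP; elim: m => [|m [vs [svs vsP le]]].
  exists [::]; split=> //; rewrite mul1r ler_nat subset_leq_card //.
  by apply/subsetP => q; rewrite inE => /andP[].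
have c1' : 0 <= 1 - c by rewrite subr_ge0.
set P' := [set q in P | _] in le.
have P'P q : q \in P' -> q \in P by rewrite inE => /andP[].
have [P'0|P'0] := eqVneq P' set0.
  exists vs; split=> //; first exact: leqW.
  by rewrite -/P' P'0 cards0 mulr_ge0 // exprn_ge0.
pose F v := #|[set q in P' | sep q v]|.
have [v vP] : exists v, c * #|P'|%:R <= (F v)%:R.
  have /card_gt0P[v0 _] := V0.
  have [v _ maxv] := @arg_maxnP _ v0 predT F isT.
  exists v; rewrite -(ler_pM2l (_ : 0 < #|V|%:R)) ?ltr0n //.
  apply: (@le_trans _ _ (\sum_v (F v)%:R)); last first.
    rewrite mulr_natl -sumr_const; apply: ler_sum => w _; rewrite ler_nat; exact: maxv.
  have -> : \sum_v (F v)%:R = \sum_(q in P') #|[set v | sep q v]|%:R :> R.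
    rewrite -!natr_sum; congr (_%:R).
    under eq_bigr => w _ do rewrite /F -sum1dep_card big_mkcondr.
    rewrite exchange_big /=; apply: eq_bigr => q _.
    by rewrite -big_mkcond sum1dep_card.
  rewrite mulrA [X in X * _]mulrC mulr_natr -sumr_const.
  by apply: ler_sum => q /P'P/sepP.
exists (v :: vs); split=> //.
- move=> w; rewrite inE => /orP[/eqP->|/vsP//].
  have : (0 < F v)%N.
    by rewrite -(ltr0n R); apply: lt_le_trans vP; rewrite mulr_gt0 // ltr0n card_gt0.
  by move=> /card_gt0P[q]; rewrite inE => /andP[/P'P qP qv]; exists q.
have E : (#|[set q in P | ~~ has (sep q) (v :: vs)]| + F v = #|P'|)%N.
  rewrite -(cardID [pred q | sep q v] P') addnC; congr (_ + _)%N; apply: eq_card => q.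
    by rewrite !inE andbC.
  by rewrite !inE /= negb_or andbCA.
have : #|[set q in P | ~~ has (sep q) (v :: vs)]|%:R + (F v)%:R = #|P'|%:R :> R.
  by rewrite -natrD E.
set x := #|_|%:R => Ex.
apply: (@le_trans _ _ ((1 - c) * #|P'|%:R)).
  by rewrite mulrBl mul1r -Ex -addrA lerDl subr_ge0 Ex.
by rewrite exprS -mulrA ler_wpM2l.
Qed.

Section ShiftDistance.
Context (G : finZmodType).
Implicit Types (A J H : {set G}) (h : G).

(** Even and subadditive in [h], hence its balls of doubling radii form a tower as in
    [subspace_in_tower]. *)
Definition shift_dist A h := #|[set x | (x \in A) != (x + h \in A)]|.

Lemma mem_shift_sub A h x : (x \in shift_sub A h) = (x + h \in A).
Proof.
apply/imsetP/idP => [[a aA ->]|xA]; first by rewrite subrK.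
by exists (x + h); rewrite // addrK.
Qed.

Lemma card_symdiff_shift A h : #|symdiff A (shift_sub A h)| = shift_dist A h.
Proof.
apply: eq_card => x; rewrite !inE mem_shift_sub.
by case: (x \in A); case: (_ \in A).
Qed.

Lemma shift_dist_pair A h h' :
  #|[set x | (x + h \in A) != (x + h' \in A)]| = shift_dist A (h - h').
Proof.
rewrite /shift_dist -[LHS](card_imset _ (addIr h')); apply: eq_card => x.
rewrite inE; apply/imsetP/idP => [[y + ->]|xA].
  by rewrite inE -addrA [h' + _]addrC subrK eq_sym.
by exists (x - h'); rewrite ?subrK // inE subrK eq_sym -addrA [- h' + _]addrC.
Qed.

Lemma shift_dist0 A : shift_dist A 0 = 0%N.
Proof. by apply/eqP; rewrite cards_eq0; apply/eqP/setP => x; rewrite !inE addr0 eqxx. Qed.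

Lemma shift_distN A h : shift_dist A (- h) = shift_dist A h.
Proof.
rewrite -[- h]add0r -shift_dist_pair; apply: eq_card => x.
by rewrite !inE addr0.
Qed.

Lemma shift_distD A h h' :
  (shift_dist A (h + h')%R <= shift_dist A h + shift_dist A h')%N.
Proof.
have -> : shift_dist A h' = #|[set x | (x + (h + h') \in A) != (x + h \in A)]|.
  by rewrite shift_dist_pair addrAC subrr add0r.
apply: leq_trans (leq_card_setU _ _).
apply/subset_leq_card/subsetP => x; rewrite !inE.
by case: (x \in A); case: (x + h \in A); case: (_ \in A).
Qed.

Lemma shift_dist_color A0 A1 A2 h : three_coloring A0 A1 A2 ->
  (shift_dist A0 h <= shift_dist A1 h + 2 * #|A2|)%N.
Proof.
move=> [cov d01 d02 d12].
have c x : (x \in A0) = ~~ ((x \in A1) || (x \in A2)).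
  have : x \in A0 :|: A1 :|: A2 by rewrite cov inE.
  rewrite !inE; case x0: (x \in A0) => /=.
    by rewrite (disjointFr d01 x0) (disjointFr d02 x0).
  by move=> ->.
have -> : (2 * #|A2| = #|A2| + #|shift_sub A2 h|)%N.
  by rewrite card_imset ?addnn ?mul2n //; apply: addIr.
apply: (@leq_trans #|[set x | (x \in A1) != (x + h \in A1)] :|: (A2 :|: shift_sub A2 h)|).
  apply/subset_leq_card/subsetP => x; rewrite !inE mem_shift_sub !c.
  by case: (x \in A1); case: (x \in A2); case: (x + h \in A1); case: (x + h \in A2).
apply: (leq_trans (leq_card_setU _ _)); rewrite leq_add2l.
exact: leq_card_setU.
Qed.

Definition separated (R : numDomainType) A (r : R) J :=
  [forall h in J, forall h' in J, (h != h') ==> (r < (shift_dist A (h - h'))%:R)].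

Lemma separatedP (R : numDomainType) A (r : R) J :
  reflect {in J &, forall h h', h != h' -> r < (shift_dist A (h - h'))%:R} (separated A r J).
Proof.
apply: (iffP forall_inP) => [P h h' hJ h'J|P h hJ].
  by have /forall_inP/(_ _ h'J)/implyP := P h hJ.
by apply/forall_inP => h' h'J; apply/implyP; apply: P.
Qed.

(** Points [v] with some v + h in [A2] have density at most [delta / 2], so every pair of shifts is
    still separated at a proportion [delta / 2] of good points. Fewer than one pair survives [m]
    greedy choices, so [J] has distinct traces on at most [m] points. A larger [J] would shatter
    [k.+1] of them, and at good points lying outside [A1] means lying in [A0]. *)
Lemma packing_le (R : realFieldType) A0 A1 A2 H J k m (delta eps : R) :
  three_coloring A0 A1 A2 -> ~ VC_dim_at_least A1 A0 (mem H) k.+1 ->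
  J \subset H -> 0 < delta <= 1 -> separated A1 (delta * #|G|%:R) J ->
  #|A2|%:R <= eps * #|G|%:R -> #|J|%:R * eps <= delta / 2 ->
  (1 - delta / 2) ^+ m * #|J|%:R ^+ 2 < 1 ->
  (#|J| <= m.+1 ^ k)%N.
Proof.
move=> col nVC JH /andP[d0 d1] /separatedP sepJ A2e Je lt1.
have G0 : (0 < #|G|)%N by apply/card_gt0P; exists 0.
pose good v := [forall h in J, v + h \notin A2].
pose sep (q : G * G) v := good v && ((v + q.1 \in A1) != (v + q.2 \in A1)).
pose P := [set q in setX J J | q.1 != q.2].
have bad_le : #|[set v | ~~ good v]|%:R <= delta / 2 * #|G|%:R.
  have h1 : (#|[set v | ~~ good v]| <= \sum_(h in J) #|shift_sub A2 h|)%N.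
    apply: (@leq_trans #|\bigcup_(h in J) shift_sub A2 h|).
      apply/subset_leq_card/subsetP => v; rewrite inE negb_forall_in => /exists_inP[h hJ].
      by rewrite negbK => vA; apply/bigcupP; exists h; rewrite // mem_shift_sub.
    elim/big_rec2: _ => [|h s1 S _ le]; first by rewrite cards0.
    by apply: (leq_trans (leq_card_setU _ _)); rewrite leq_add2l.
  rewrite -(ler_nat R) in h1; apply: (le_trans h1).
  rewrite (eq_bigr (fun=> #|A2|)) => [|h _]; last by rewrite card_imset //; apply: addIr.
  rewrite sum_nat_const natrM; apply: (@le_trans _ _ (#|J|%:R * (eps * #|G|%:R))).
    by rewrite ler_wpM2l.
  by rewrite mulrA ler_wpM2r.
have sepP q : q \in P -> delta / 2 * #|G|%:R <= #|[set v | sep q v]|%:R.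
  case: q => h h'; rewrite !inE /= => /andP[/andP[hJ h'J] hh'].
  have := sepJ _ _ hJ h'J hh'; rewrite -shift_dist_pair => lt.
  have : (#|[set x | ((x + h)%R \in A1) != ((x + h')%R \in A1)]| <=
     #|[set v | sep (h, h') v]| + #|[set v | ~~ good v]|)%N.
    apply: leq_trans (leq_card_setU _ _); apply/subset_leq_card/subsetP => v.
    by rewrite !inE /sep /= => ->; rewrite andbT orbN.
  rewrite -(ler_nat R) natrD.
  move: lt bad_le; clear; set a := #|_|%:R; set b := #|_|%:R; set c := #|_|%:R.
  by move: (#|G|%:R : R) => N; lra.
have c_itv : 0 < delta / 2 <= 1 by move: d0 d1; clear; lra.
have [vs [svs vs_good le]] := greedy_separation m c_itv G0 sepP.
have none : [set q in P | ~~ has (sep q) vs] = set0.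
  apply/eqP; rewrite -cards_eq0 -leqn0 -ltnS -(ltr_nat R).
  apply: (le_lt_trans le); apply: le_lt_trans lt1.
  rewrite ler_wpM2l ?exprn_ge0 ?subr_ge0 //; first by case/andP: c_itv.
  rewrite -natrX ler_nat -mulnn -cardsX subset_leq_card //.
  by apply/subsetP => q; rewrite inE => /andP[].
have goodP v : v \in vs -> good v by move=> /vs_good[q _ /andP[]].
rewrite leqNgt; apply/negP => ltJ.
have inj : {in enum J &, injective (fun h => [seq v + h \in A1 | v <- vs])}.
  move=> h h'; rewrite !mem_enum => hJ h'J /eq_in_map E.
  apply/eqP/negPn/negP => hh'.
  have : (h, h') \in [set q in P | ~~ has (sep q) vs].
    rewrite !inE hJ h'J hh' /=; apply/hasPn => v vvs.
    by rewrite /sep /= E // eqxx andbF.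
  by rewrite none inE.
have szJ : (\sum_(i < k.+1) 'C(size vs, i) < size (enum J))%N.
  rewrite -cardE; apply: leq_ltn_trans ltJ; apply: (leq_trans (sum_bin_le _ _)).
  by case: (k) => // k'; rewrite leq_exp2r.
have [t [st tvs tP]] := sauer_shelah (enum_uniq (mem J)) inj szJ.
apply: nVC.
pose bits (S : {set 'I_k.+1}) := [seq i \in S | i <- enum 'I_k.+1].
have bitsP S : exists h, (h \in J) && ([seq v + h \in A1 | v <- t] == bits S).
  have [|h hJ E] := tP (bits S); first by rewrite size_map size_enum_ord.
  by exists h; rewrite -mem_enum hJ E eqxx.
exists (fun i => nth 0 t i), (fun S => xchoose (bitsP S)) => S.
have /andP[hJ /eqP E] := xchooseP (bitsP S).
set h := xchoose _ in hJ E *.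
split=> [|i]; first exact: (subsetP JH).
have iS : (nth 0 t i + h \in A1) = (i \in S).
  have := congr1 (fun s => nth false s i) E.
  rewrite (nth_map 0) ?st // => ->.
  by rewrite (nth_map i) ?size_enum_ord // nth_ord_enum.
have := goodP (nth 0 t i) (tvs _ (mem_nth _ _)).
rewrite st ltn_ord => /(_ isT)/forall_inP/(_ _ hJ) nA2.
rewrite iS; split=> // niS.
have [cov _ _ _] := col.
have : nth 0 t i + h \in A0 :|: A1 :|: A2 by rewrite cov inE.
by rewrite !inE iS (negbTE niS) (negbTE nA2) !orbF.
Qed.

(** A maximal separated set is a net, so translates of the ball by its elements cover [H]. Excluding
    the single size [M] suits [packing_le], whose hypotheses involve [#|J|]; the maximum is taken
    among sets of size at most [M]. *)
Lemma ball_covering (R : realFieldType) A H (r : R) M :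
  0 <= r -> {in H &, forall x y, x - y \in H} ->
  (forall J, J \subset H -> separated A r J -> #|J| <> M) ->
  (#|H| <= M * #|[set h in H | ((shift_dist A h)%:R <= r)%R]|)%N.
Proof.
move=> r0 HB nJ; set B := [set h in H | _].
pose P J := [&& J \subset H, separated A r J & (#|J| <= M)%N].
have P0 : P set0.
  by rewrite /P sub0set cards0 !andbT; apply/separatedP => h; rewrite inE.
have [J /and3P[JH sepJ leJ] maxJ] := @arg_maxnP _ set0 P (fun J => #|J|) P0.
have ltJ : (#|J| < M)%N by rewrite ltn_neqAle leJ andbT; apply/eqP/nJ.
have cover h : h \in H -> exists2 j, j \in J & (shift_dist A (h - j))%:R <= r.
  move=> hH; apply/exists_inP; rewrite -[X in is_true X]negbK negb_exists_in.
  apply/negP => /forall_inP far.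
  have hJ : h \notin J by apply/negP => /far; rewrite subrr shift_dist0 r0.
  suff : (#|h |: J| <= #|J|)%N by rewrite cardsU1 hJ add1n ltnn.
  apply: maxJ; rewrite /P subUset sub1set hH JH cardsU1 hJ ltJ !andbT /=.
  apply/separatedP => x y; rewrite !inE => /orP[/eqP->|xJ] /orP[/eqP->|yJ] xy.
  - by rewrite eqxx in xy.
  - by rewrite ltNge far.
  - by rewrite -shift_distN opprB ltNge far.
  by move/separatedP: sepJ; apply.
apply: (@leq_trans #|[set q.1 + q.2 | q in setX J B]|); last first.
  by apply: (leq_trans (leq_imset_card _ _)); rewrite cardsX leq_mul2r leJ orbT.
apply/subset_leq_card/subsetP => h hH; have [j jJ hj] := cover h hH.
apply/imsetP; exists (j, h - j); last by rewrite /= addrC subrK.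
by rewrite !inE /= jJ hj andbT HB // (subsetP JH).
Qed.
End ShiftDistance.

(** [Y] is the majority vote of [A] on each coset. At a point where [A] and [Y] differ, at least
    half of the shifts in [V] change membership in [A]; double counting gives the factor 2. *)
Lemma coset_rounding (R : realFieldType) p n (V : {vspace 'rV['F_p]_n})
    (A : {set 'rV['F_p]_n}) (r : R) :
  (forall h, h \in V -> (shift_dist A h)%:R <= r) ->
  exists Y : {set 'rV['F_p]_n}, union_of_cosets V Y /\ #|symdiff A Y|%:R <= 2 * r.
Proof.
move=> Vr.
pose N (x : 'rV['F_p]_n) := #|[set h in V | x + h \in A]|.
pose Y := [set x | (#|V| <= 2 * N x)%N].
have NV x h : h \in V -> N (x + h) = N x.
  move=> hV; rewrite /N -[LHS](card_imset _ (addrI h)); apply: eq_card => u.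
  rewrite [RHS]inE; apply/imsetP/andP => [[w + ->]|[uV uA]].
    by rewrite inE addrA => /andP[wV ->]; rewrite memvD.
  exists (u - h); last by rewrite addrC subrK.
  by rewrite inE memvB //= addrACA subrr addr0.
have V0 : (0 < #|V|)%N by apply/card_gt0P; exists 0; apply: mem0v.
exists Y; split.
  exists Y; apply/setP => x; apply/idP/bigcupP => [xY|[b bY /imsetP[h hV ->]]].
    by exists x => //; apply/imsetP; exists 0; rewrite ?addr0 // mem0v.
  by move: bY; rewrite !inE NV.
have h1 : (#|symdiff A Y| * #|V| <= 2 * \sum_(h in V) shift_dist A h)%N.
  have -> : (\sum_(h in V) shift_dist A h =
      \sum_x #|[set h in V | ((x \in A) != ((x + h)%R \in A))]|)%N.
    under eq_bigr => h _ do rewrite /shift_dist -sum1dep_card big_mkcond /=.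
    rewrite exchange_big; apply: eq_bigr => x _ /=.
    by rewrite -big_mkcondr sum1dep_card.
  rewrite -sum_nat_const big_distrr /= [leqLHS]big_mkcond /=.
  apply: leq_sum => x _; case: ifP => //.
  have NE : (#|[set h in V | (x + h)%R \notin A]| + N x = #|V|)%N.
    rewrite addnC /N -(cardID [pred h | x + h \in A] V); congr (_ + _)%N.
      by apply: eq_card => h; rewrite !inE andbC.
    by apply: eq_card => h; rewrite !inE andbC.
  rewrite !inE; case xA: (x \in A); rewrite ?andbF ?andbT ?orbF /=.
    rewrite -ltnNge => lt.
    have -> : #|[set h in V | true != (x + h \in A)]| = #|[set h in V | x + h \notin A]|.
      by apply: eq_card => h; rewrite !inE; case: (_ \in A).
    by rewrite -NE mul2n -addnn leq_add2l; move: lt; rewrite -NE mul2n -addnn ltn_add2r => /ltnW.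
  have -> : #|[set h in V | false != (x + h \in A)]| = N x.
    by apply: eq_card => h; rewrite !inE; case: (_ \in A).
  by [].
have V0' : 0 < #|V|%:R :> R by rewrite ltr0n.
rewrite -(ler_pM2r V0') -natrM.
apply: (@le_trans _ _ (2 * \sum_(h in V) shift_dist A h)%:R); first by rewrite ler_nat.
rewrite natrM natr_sum -mulrA ler_wpM2l //.
by apply: (le_trans (ler_sum _ Vr)); rewrite sumr_const -[leLHS]mulr_natl mulrC.
Qed.

Lemma vspace_index p n (V W : {vspace 'rV['F_p]_n}) : (V <= W)%VS ->
  (#|V| * #|[set x in W] : [set x in V]|%g)%N = #|W|.
Proof.
move=> VW.
have gset (Z : {vspace 'rV['F_p]_n}) : group_set [set x in Z].
  apply/group_setP; split; first by rewrite inE mem0v.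
  by move=> x y; rewrite !inE => xZ yZ; apply: memvD.
have cZ (Z : {vspace 'rV['F_p]_n}) : #|[set x in Z]| = #|Z|.
  by apply: eq_card => x; rewrite inE.
rewrite -(cZ V) -(cZ W); apply: (@Lagrange _ (Group (gset W)) (Group (gset V))).
by apply/subsetP => x; rewrite !inE; apply: (subvP VW).
Qed.

Lemma doubling_pigeonhole (b : nat -> nat) s M : (0 < M)%N -> (0 < b 0)%N ->
  (b M <= 2 ^ (s * M) * b 0)%N ->
  exists2 i, (i < M)%N & (b i.+1 <= 2 ^ s * b i)%N.
Proof.
move=> M0 b0 bM.
have [/existsP[i ib]|] := boolP [exists i : 'I_M, (b i.+1 <= 2 ^ s * b i)%N].
  by exists i.
rewrite negb_exists => /forallP big; exfalso.
(* The summand [(0 < i)], read as 0 or 1, records that the growth is strict from the first step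
   on. *)
have : forall i, (i <= M)%N -> (2 ^ (s * i) * b 0 + (0 < i) <= b i)%N.
  elim=> [|i IHi] iM; first by rewrite muln0 mul1n addn0.
  have := big (Ordinal iM); rewrite /= -ltnNge addn1; apply: leq_ltn_trans.
  rewrite mulnS expnD -mulnA leq_mul2l; apply/orP; right.
  by apply: leq_trans (IHi (ltnW iM)); rewrite leq_addr.
by move=> /(_ M (leqnn M)); rewrite M0 addn1 ltnNge bM.
Qed.

Lemma small_ball_large (R : realType) (k : nat) :
  exists2 delta0 : R, 0 < delta0 < expR (-1) & forall delta eps : R,
    0 < delta -> delta < delta0 -> eps <= (delta / 120) ^+ k.+2 ->
  forall (G : finZmodType) (H A0 A1 A2 : {set G}),
    {in H &, forall x y, x - y \in H} ->
    three_coloring A0 A1 A2 -> #|A2|%:R <= eps * #|G|%:R ->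
    ~ VC_dim_at_least A1 A0 (mem H) k.+1 ->
    #|H|%:R <= delta^-1 ^+ k.+1 *
      #|[set h in H | (shift_dist A1 h)%:R <= delta * #|G|%:R]|%:R.
Proof.
(* [K] serves in [m.+1 <= K * L / delta], with [L] = log(1/delta). Since [L > X], 2 (K L)^k is at
   most L^(k+1)/(k+1)!, a term of the series of exp L = 1/delta; so [m.+1 ^ k] is at most half of
   delta^(-k-1). The summand 2 in [X] ensures [L >= 2]. *)
pose K : R := 4 * k.+1%:R + 1.
have K1 : 1 <= K by rewrite /K lerDr mulr_ge0.
pose X : R := 2 * K ^+ k * (k.+1)`!%:R + 2.
have X2 : 2 <= X by rewrite /X lerDr !mulr_ge0 // exprn_ge0 // (le_trans _ K1).
exists (expR (- X)); first by rewrite expR_gt0 ltr_expR ltrN2 (lt_le_trans _ X2) // ltr1n.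
move=> delta eps d0 dX epsle G H A0 A1 A2 HB col A2e nVC.
pose L := ln delta^-1.
have di0 : 0 < delta^-1 by rewrite invr_gt0.
have eL : expR L = delta^-1 by rewrite lnK.
have XL : X < L.
  by rewrite -ltr_expR eL -[expR X]invrK -expRN ltf_pV2 // posrE expR_gt0.
have L2 : 2 <= L by apply: ltW; apply: le_lt_trans X2 XL.
have L0 : 0 <= L by apply: le_trans L2.
have di2 : 2 <= delta^-1.
  by rewrite -eL; apply: le_trans (expR_ge1Dx _); move: L2; clear; lra.
have d1 : delta <= 2^-1 by rewrite -[delta]invrK lef_pV2 // posrE.
pose D : R := delta^-1 ^+ k.+1.
have D0 : 0 < D by rewrite exprn_gt0.
pose M := Num.truncn D.
have /andP[MD DM] : M%:R <= D < M.+1%:R by apply: truncn_itv; apply: ltW.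
(* Separating all pairs of [M] shifts needs exp(-delta m/2) delta^(-2(k+1)) < 1, that is, m >
   [T]. *)
pose T : R := 4 * k.+1%:R * L * delta^-1.
have T0 : 0 <= T by rewrite !mulr_ge0 // ltW.
pose m := (Num.truncn T).+1.
have /andP[mT Tm] : (Num.truncn T)%:R <= T < m%:R by apply: truncn_itv.
have Mk : (m.+1 ^ k < M)%N.
  rewrite -(ltr_nat R) natrX.
  have m1 : m.+1%:R <= K * L * delta^-1.
    have -> : m.+1%:R = (Num.truncn T)%:R + 2 :> R by rewrite -natrD addn2.
    have -> : K * L * delta^-1 = T + L * delta^-1 by rewrite /K /T; ring.
    rewrite lerD //; apply: (le_trans L2).
    by rewrite ler_peMr // (le_trans _ di2) // ler1n.
  have e1 : L ^+ k.+1 / (k.+1)`!%:R <= delta^-1.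
    by rewrite -eL; apply: le_trans (expR_ge1Dxn k L0); rewrite lerDr.
  have e2 : 2 * (K * L) ^+ k <= delta^-1.
    apply: le_trans e1; rewrite ler_pdivlMr ?ltr0n ?fact_gt0 //.
    rewrite exprMn exprS mulrA [leLHS]mulrAC ler_wpM2r ?exprn_ge0 //.
    apply: le_trans (ltW XL); by rewrite /X lerDl.
  have D2 : 2 <= D.
    by apply: (le_trans di2); rewrite /D ler_eXnr // (le_trans _ di2) // ler1n.
  have e3 : m.+1%:R ^+ k <= D / 2.
    rewrite ler_pdivlMr // /D exprS.
    apply: (@le_trans _ _ ((K * L * delta^-1) ^+ k * 2)).
      rewrite ler_wpM2r // lerXn2r ?nnegrE // !mulr_ge0 ?(ltW di0) //.
      exact: le_trans K1.
    rewrite exprMn mulrAC ler_wpM2r ?exprn_ge0 ?(ltW di0) //.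
    by rewrite mulrC.
  have aux (x y z : R) : x <= y / 2 -> y < z + 1 -> 2 <= y -> x < z by clear; lra.
  by apply: aux e3 _ D2; rewrite natr1.
have cov : (#|H| <= M * #|[set h in H | ((shift_dist A1 h)%:R <= delta * #|G|%:R)%R]|)%N.
  apply: ball_covering => // [|J JH sepJ cJ]; first by rewrite mulr_ge0 // ltW.
  suff : (#|J| <= m.+1 ^ k)%N by rewrite cJ leqNgt Mk.
  apply: (@packing_le _ _ _ _ _ H J k m delta eps col nVC JH) => //.
  - by rewrite d0 (le_trans d1) // invf_le1 // ler1n.
  - rewrite cJ; apply: (@le_trans _ _ (D * (delta / 120) ^+ k.+2)).
      apply: (le_trans (ler_wpM2l _ epsle)) => //.
      by rewrite ler_wpM2r // exprn_ge0 // divr_ge0 // ltW.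
    rewrite /D [X in _ * X]exprSr mulrA -exprMn [delta^-1 * _]mulrA mulVf ?lt0r_neq0 // mul1r.
    rewrite mulrCA ler_wpM2l ?(ltW d0) //.
    apply: (@le_trans _ _ (1 * 120^-1)).
      by rewrite ler_wpM2r ?invr_ge0 // exprn_ile1 ?invr_ge0 // invf_le1 // ler1n.
    by rewrite mul1r lef_pV2 ?posrE // ler_nat.
  rewrite cJ.
  have h1 : (1 - delta / 2) ^+ m <= expR (- (delta / 2) * m%:R).
    rewrite expRM_natr lerXn2r ?nnegrE ?expR_ge0 //.
      by move: d1; clear; lra.
    exact: expR_ge1Dx.
  have h2 : M%:R ^+ 2 <= expR (2 * k.+1%:R * L).
    have -> : expR (2 * k.+1%:R * L) = D ^+ 2.
      by rewrite -mulrA expRM_natl expRM_natl eL.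
    by rewrite lerXn2r ?nnegrE // ltW.
  apply: (@le_lt_trans _ _ (expR (- (delta / 2) * m%:R) * expR (2 * k.+1%:R * L))).
    by apply: ler_pM; rewrite // ?exprn_ge0 //; move: d1; clear; lra.
  rewrite -expRD expR_lt1.
  have dT : delta * T = 4 * (k.+1%:R * L) by rewrite /T; field; apply: lt0r_neq0.
  have : delta * T < delta * m%:R by rewrite ltr_pM2l.
  rewrite dT -[2 * k.+1%:R * L]mulrA.
  by move: (k.+1%:R * L) (m%:R : R) => z w; clear; lra.
apply: (@le_trans _ _ (M * #|[set h in H | ((shift_dist A1 h)%:R <= delta * #|G|%:R)%R]|)%:R).
  by rewrite ler_nat.
by rewrite natrM ler_wpM2r.
Qed.

(** * The structure theorem *)

(** Scales grow by 16 = 2^4 because the tower doubles its radius four times. The subspace lies at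
    level 2, of radius 4 r 16^i with i < M, hence the division by 4. *)
Lemma doubling_subspace (R : realType) p (p_prime : prime p) : exists c : nat,
  forall n (H : {vspace 'rV['F_p]_n}) (A : {set 'rV['F_p]_n}) (r : R) s M,
  let ball (t : R) := [set h in H | (shift_dist A h)%:R <= t] in
  0 <= r -> (0 < M)%N -> (#|H| <= 2 ^ (s * M) * #|ball r|)%N ->
  exists V : {vspace 'rV['F_p]_n},
    [/\ (V <= H)%VS, forall h, h \in V -> (shift_dist A h)%:R <= r * 16 ^+ M / 4
      & (#|ball r| <= #|V| * p ^ (c * (s + p) ^ 4))%N].
Proof.
have [c tower] := subspace_in_tower R p_prime; exists c => n H A r s M ball r0 M0 HM.
have ballS t u : t <= u -> ball t \subset ball u.
  move=> tu; apply/subsetP => h; rewrite !inE => /andP[-> /le_trans]; exact.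
have ball0 t : 0 <= t -> 0 \in ball t by move=> t0; rewrite inE mem0v shift_dist0.
pose b i := #|ball (r * 16 ^+ i)|.
have pow0 i : 0 <= r * 16 ^+ i by rewrite mulr_ge0 // exprn_ge0.
have [| |i iM bi] := @doubling_pigeonhole b s M M0.
- by apply/card_gt0P; exists 0; apply: ball0.
- rewrite {2}/b mulr1; apply: leq_trans HM; rewrite subset_leq_card //.
  by apply/subsetP => h; rewrite inE => /andP[].
pose B j := ball (r * 16 ^+ i * 2 ^+ j).
have [||||V [VB cV]] := tower n s B.
- by move=> j; apply: ball0; rewrite mulr_ge0 // exprn_ge0.
- by move=> j x; rewrite !inE memvN shift_distN.
- move=> j x y; rewrite !inE => /andP[xH dx] /andP[yH dy]; rewrite memvD //=.
  apply: (@le_trans _ _ (shift_dist A x + shift_dist A y)%N%:R).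
    by rewrite ler_nat shift_distD.
  rewrite natrD exprSr mulrA mulr_natr mulr2n; exact: lerD.
- rewrite {2}/B mulr1; apply: leq_trans bi; rewrite /b /B subset_leq_card // ballS //.
  by rewrite [16 ^+ i.+1]exprSr mulrA; apply: ler_wpM2l; rewrite ?pow0 -?natrX ?ler_nat.
exists V; split.
- by apply/subvP => h /VB; rewrite inE => /andP[].
- move=> h /VB; rewrite inE => /andP[_ /le_trans]; apply.
  rewrite -!mulrA ler_wpM2l // -(ler_pM2r (_ : 0 < 4)) // mulfVK ?pnatr_eq0 //.
  apply: (@le_trans _ _ (16 ^+ i.+1)); last by rewrite ler_weXn2l // ler1n.
  by rewrite exprSr -mulrA ler_wpM2l ?exprn_ge0 // -natrX -natrM.
apply: leq_trans cV; rewrite /B mulr1 subset_leq_card // ballS //.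
by rewrite ler_peMr // exprn_ege1 // ler1n.
Qed.

Lemma powR_shift (R : realType) (delta x w : R) : 0 < delta ->
  delta `^ (x - w) = delta `^ x * expR (w * ln delta^-1).
Proof.
move=> d0; rewrite /powR gt_eqF // -expRD; congr expR.
by rewrite lnV ?posrE // mulrBl mulrN.
Qed.

(* With y = log(1/delta)^(1/5), there are M ~ y^4 scales, and the doubling
   constant at the best one has logarithm s ~ y, so that both s^4 and M are
   O(y^4) = O(psi(delta) log(1/delta)). *)
Lemma scale_parameters (R : realType) (delta : R) :
  0 < delta -> delta < expR (-1) ->
  exists a : nat, [/\ (0 < a)%N, ln delta^-1 <= a%:R ^+ 5
    & forall sigma : R, 0 <= sigma ->
      sigma * (a ^ 4)%:R <= psi (16 * sigma) delta * ln delta^-1].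
Proof.
move=> d0 d1; set L := ln delta^-1.
have L1 : 1 <= L.
  have di0 : 0 < delta^-1 by rewrite invr_gt0.
  rewrite -ler_expR lnK //.
  by rewrite -[expR 1]invrK -expRN lef_pV2 ?posrE ?expR_gt0 // ltW.
have L0 : 0 < L by apply: lt_le_trans L1.
pose y := L `^ 5^-1.
have y0 : 0 < y by rewrite powR_gt0.
have y5 : y ^+ 5 = L by rewrite -powR_mulrn ?ltW // -powRrM mulVf ?pnatr_eq0 // powRr1 // ltW.
have y1 : 1 <= y.
  by rewrite -(ler_pXn2r (isT : (0 < 5)%N)) ?nnegrE ?ler01 ?(ltW y0) // expr1n y5.
have /andP[ay ya] : (Num.truncn y)%:R <= y < (Num.truncn y).+1%:R.
  by apply: truncn_itv; apply: ltW.
exists (Num.truncn y).+1; set a := (Num.truncn y).+1 in ya *.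
split=> // [|sigma s0].
  by rewrite -y5 lerXn2r ?nnegrE // ltW.
(* Rounding up costs at most a factor 2 because [y >= 1]; its fourth power is the 16 in [psi]. *)
have a2 : a%:R <= 2 * y by rewrite /a -natr1; move: ay y1; clear; lra.
rewrite /psi powRN -/y -/L -y5 natrX.
have -> : 16 * sigma * y^-1 * y ^+ 5 = sigma * (2 * y) ^+ 4.
  by field; apply: lt0r_neq0.
by rewrite ler_wpM2l // lerXn2r ?nnegrE // mulr_ge0 // ltW.
Qed.

(* The group law of the finGroupType 'rV['F_p]_n is addition, so #|_ : _|%g is
   the index of additive subgroups. *)
Theorem theorem3p4 (R : realType) (p k : nat) (p_prime : prime p) :
  exists delta0 sigma : R,
    [/\ 0 < delta0, delta0 < 1, 0 < sigma &
    forall delta eps : R,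
      0 < delta -> delta < delta0 ->
      0 < eps -> eps <= (delta / 120) ^+ k.+1 ->
    forall (n : nat) (H : {vspace 'rV['F_p]_n})
           (A0 A1 A2 : {set 'rV['F_p]_n}),
      three_coloring A0 A1 A2 ->
      #|A2|%:R <= eps * #|{: 'rV['F_p]_n}|%:R ->
      ~ VC_dim_at_least A1 A0 H k ->
    exists H' : {vspace 'rV['F_p]_n},
      [/\ (H' <= H)%VS,
          #|[set x in H] : [set x in H']|%g%:R
            <= delta `^ (- k%:R - psi sigma delta),
          forall A, A \in [:: A0; A1] ->
          forall h, h \in H' ->
            #|symdiff A (shift_sub A h)|%:R
              <= 4 * delta `^ (1 - psi sigma delta)
                 * #|{: 'rV['F_p]_n}|%:R
        & forall A, A \in [:: A0; A1] ->
          exists Y : {set 'rV['F_p]_n},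
            union_of_cosets H' Y /\
            #|symdiff A Y|%:R
              <= 4 * delta `^ (1 - psi sigma delta)
                 * #|{: 'rV['F_p]_n}|%:R]].
Proof.
(* VC-dimension at least 0 always holds, with 0 in [H] as the only witness, so the case k = 0 is
   vacuous. *)
case: k => [|k].
  exists 2^-1, 1; split; rewrite ?invr_gt0 ?invf_lt1 ?ltr1n //.
  move=> delta eps _ _ _ _ n H A0 A1 A2 _ _ [].
  by exists (fun=> 0), (fun=> 0) => S; split=> [|[]//]; rewrite mem0v.
have [c doubling] := doubling_subspace R p_prime.
have [delta0 /andP[delta00 delta0e] small_ball] := small_ball_large R k.
(* Chosen so that [c * (s + p) ^ 4 <= E * a ^ 4] when [s = 2 * k.+1 * a]. In [tau], [p * E] pays for
   the index through p <= exp p, and 4 pays for 16 <= exp 4. *)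
pose E := (c * (2 * k.+1 + p) ^ 4)%N.
pose tau : R := (p * E)%:R + 4.
have tau4 : 4 <= tau by rewrite lerDr.
exists delta0, (16 * tau); split=> //.
- by apply: (lt_trans delta0e); rewrite expR_lt1 ltrN10.
- by rewrite mulr_gt0 // (lt_le_trans _ tau4).
move=> delta eps d0 dlt eps0 epsle n H A0 A1 A2 col A2e nVC.
have [a [a0 La aW]] := scale_parameters d0 (lt_trans dlt delta0e).
set L := ln delta^-1 in La aW.
have eL : expR L = delta^-1 by rewrite lnK // posrE invr_gt0.
set N : R := #|{: 'rV['F_p]_n}|%:R in A2e *.
(* Then 2^(s M) = 4^((k+1) a^5), which exceeds delta^(-k-1) because exp 1 <= 4 and log(1/delta) <=
   a^5. *)
pose M := (a ^ 4)%N; pose s := (2 * k.+1 * a)%N.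
have M0 : (0 < M)%N by rewrite expn_gt0 a0.
pose W := expR (psi (16 * tau) delta * L).
have tauW : expR (tau * M%:R) <= W by rewrite ler_expR aW // (le_trans _ tau4).
have -> : delta `^ (- k.+1%:R - psi (16 * tau) delta) = delta^-1 ^+ k.+1 * W.
  by rewrite powR_shift // powRN powR_mulrn ?ltW // exprVn.
have -> : delta `^ (1 - psi (16 * tau) delta) = delta * W.
  by rewrite powR_shift // powRr1 // ltW.
have D0 : 0 < delta^-1 ^+ k.+1 by rewrite exprn_gt0 // invr_gt0.
pose Hs := [set x in H].
have cH : #|Hs| = #|H| by apply: eq_card => x; rewrite inE.
have cB t : #|[set h in Hs | (shift_dist A1 h)%:R <= t]| =
    #|[set h in H | (shift_dist A1 h)%:R <= t]|.
  by apply: eq_card => x; rewrite !inE.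
have HsB : {in Hs &, forall x y, x - y \in Hs}.
  by move=> x y; rewrite !inE; apply: memvB.
have nVCs : ~ VC_dim_at_least A1 A0 (mem Hs) k.+1.
  move=> [v [w vw]]; apply: nVC; exists v, w => S.
  by have [wS wP] := vw S; split=> //; move: wS; rewrite !inE.
have := small_ball delta eps d0 dlt epsle _ Hs A0 A1 A2 HsB col A2e nVCs.
rewrite cH cB -/N; set B := [set h in H | _] => Hle.
have rN : 0 <= delta * N by rewrite mulr_ge0 // ltW.
have HM : (#|H| <= 2 ^ (s * M) * #|B|)%N.
  rewrite -(ler_nat R) natrM; apply: (le_trans Hle); rewrite ler_wpM2r //.
  have -> : (s * M = 2 * (a ^ 5 * k.+1))%N by rewrite /s /M expnS; ring.
  rewrite expnM natrX -eL -natrX expnM natrX lerXn2r ?nnegrE ?expR_ge0 //.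
  apply: (@le_trans _ _ (expR 1 ^+ (a ^ 5))).
    by rewrite -expRM_natr mul1r ler_expR natrX.
  by rewrite natrX lerXn2r ?nnegrE ?expR_ge0 // expR1_le4.
have [V [VH VA1 cV]] := doubling n H A1 (delta * N) s M rN M0 HM.
have e16 : 16 ^+ M <= W.
  apply: le_trans tauW; rewrite expRM_natr lerXn2r ?nnegrE ?expR_ge0 //.
  apply: (@le_trans _ _ (expR 4)); last by rewrite ler_expR.
  rewrite -[4]mul1r expRM_natr; have -> : (16 : R) = 2 ^+ 4 by rewrite -natrX.
  rewrite lerXn2r ?nnegrE ?expR_ge0 //.
  by have := expR_ge1Dx (1 : R).
pose r := delta * N * 16 ^+ M.
have rW : r <= delta * W * N.
  by rewrite /r mulrAC ler_wpM2r // ler_wpM2l // ltW.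
have e1 : 1 <= 16 ^+ M :> R by rewrite exprn_ege1 // ler1n.
(* The distance is at most [r / 4] for [A1], and [A0] adds [2 * #|A2|], again at most [r / 4] since
   [eps <= delta / 120]. Rounding to cosets doubles [r / 2] to [r]. *)
have VA : forall A, A \in [:: A0; A1] -> forall h, h \in V -> (shift_dist A h)%:R <= r / 2.
  have r0 : 0 <= r by rewrite mulr_ge0 // (le_trans _ e1).
  move=> A; rewrite !inE => /orP[/eqP->|/eqP->] h /VA1; rewrite -/r => le; last first.
    by move: le r0; clear; lra.
  have := shift_dist_color h col; rewrite -(ler_nat R) natrD natrM => /le_trans; apply.
  have le2 : 2 * #|A2|%:R <= r / 4.
    have d1 : delta <= 1.
      by rewrite ltW // (lt_trans dlt) // (lt_trans delta0e) // expR_lt1 ltrN10.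
    have e2 : eps <= delta / 120.
      apply: (le_trans epsle); rewrite exprS ger_pMr ?divr_gt0 //.
      rewrite exprn_ile1 ?divr_ge0 ?(ltW d0) // ler_pdivrMr // mul1r.
      by rewrite (le_trans d1) // ler1n.
    have : delta * N <= r by rewrite ler_peMr.
    have : eps * N <= delta / 120 * N by rewrite ler_wpM2r.
    by move: A2e rN; clear; lra.
  by move: le le2; clear; lra.
have rfin : r <= 4 * (delta * W) * N.
  move: rW; have : 0 <= delta * W * N by rewrite !mulr_ge0 ?expR_ge0 // ltW.
  by rewrite -mulrA; clear; lra.
exists V; split=> //.
- have V0 : 0 < #|V|%:R :> R by rewrite ltr0n; apply/card_gt0P; exists 0; apply: mem0v.
  rewrite -(ler_pM2l V0) -natrM vspace_index //.
  apply: (le_trans Hle); rewrite mulrCA ler_wpM2l ?(ltW D0) //.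
  apply: (@le_trans _ _ (#|V| * p ^ (E * M))%:R).
    rewrite ler_nat; apply: (leq_trans cV); rewrite leq_mul2l; apply/orP; right.
    rewrite leq_pexp2l ?prime_gt0 // /E -mulnA leq_mul2l -expnMn leq_exp2r //.
    by rewrite /s mulnDl leq_add2l leq_pmulr // orbT.
  rewrite natrM ler_wpM2l //; apply: le_trans tauW.
  apply: (@le_trans _ _ (expR ((p * E)%:R * M%:R))); last first.
    by rewrite ler_expR ler_wpM2r // lerDl.
  rewrite natrX -[_ * M%:R]natrM -mulnA natrM expRM_natr.
  rewrite lerXn2r ?nnegrE ?expR_ge0 //.
  by apply: le_trans (expR_ge1Dx _); rewrite lerDr.
- move=> A AA h hV; rewrite card_symdiff_shift; apply: le_trans rfin.
  apply: (le_trans (VA A AA h hV)).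
  have : 0 <= r by rewrite mulr_ge0 // (le_trans _ e1).
  by clear; lra.
move=> A AA; have [Y [YV YA]] := coset_rounding (VA A AA).
by exists Y; split=> //; apply: le_trans rfin; rewrite mulrC divfK ?pnatr_eq0 in YA.
Qed.
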